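(* Let $d \in \mathbb{N}_{>0}$, let $M := (S^1)^d$ be the $d$-torus, let $\Gamma := \pi_1(M) \cong \mathbb{Z}^d$, and let $\alpha = \Gamma \curvearrowright (X,\mu)$ be an essentially free standard $\Gamma$-space. Then \[ C_*(M;\alpha) = L^\infty(X;\mathbb{Z}) \otimes_{\mathbb{Z}\Gamma} C_*(\widetilde{M};\mathbb{Z}) \] satisfies the uniform boundary condition in every degree, i.e.: for every $n \in \mathbb{N}$ there is a constant $K \in \mathbb{R}_{>0}$ such that for every null-homologous cycle $c \in C_n(M;\alpha)$ there exists a chain $b \in C_{n+1}(M;\alpha)$ with \[ \partial b = c \quad\text{and}\quad |b|_1 \leq K \cdot |c|_1. \]
   Context: For a countable group $\Gamma$, a standard $\Gamma$-space is a standard Borel probability space $(X,\mu)$ together with a measurable probability-measure-preserving left $\Gamma$-action; it is essentially free if $\mu$-almost every point has trivial stabiliser. $L^\infty(X;\mathbb{Z}) = L^\infty(X,\mu;\mathbb{Z})$ is the group of (almost everywhere classes of) essentially bounded measurable functions $X \to \mathbb{Z}$, with norm $|f| = \int_X |f|\,d\mu$ and right $\Gamma$-action $(f\cdot\gamma)(x) = f(\gamma\cdot x)$. $\widetilde{M}$ is the universal covering of $M$ and $C_*(\widetilde{M};\mathbb{Z})$, the integral singular chain complex, carries the left $\mathbb{Z}\Gamma$-structure induced by deck transformations. The norm on $C_n(M;\alpha)$ is $\bigl|\sum_{j=1}^m f_j \otimes \sigma_j\bigr|_1 := \sum_{j=1}^m \int_X |f_j|\,d\mu$, where the sum is in reduced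 form, i.e., the singular simplices $\sigma_1,\dots,\sigma_m$ of $\widetilde{M}$ lie in pairwise different $\Gamma$-orbits. A cycle is null-homologous if it is a boundary in the chain complex $C_*(M;\alpha)$. *)

(* Defs.v *)
From HB Require Import structures.
From mathcomp Require Import all_boot all_order all_algebra.
From mathcomp Require Import generic_quotient ring_quotient freeg.
From mathcomp Require Import ring lra.
From mathcomp Require Import all_classical all_reals all_analysis.

Set Implicit Arguments.
Unset Strict Implicit.
Unset Printing Implicit Defensive.

Import Order.TTheory GRing.Theory Num.Theory.
Import numFieldNormedType.Exports.

Local Open Scope classical_set_scope.
Local Open Scope ring_scope.
Local Open Scope quotient_scope.

Section StandardSpace.

(* A complete pseudometric space that is Hausdorff and second countable is a
   Polish space; X is standard Borel when it is Borel isomorphic to one. *)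
Definition standard_borel (R : realType) (disp : measure_display)
    (X : measurableType disp) : Prop :=
  exists (Y : completePseudoMetricType R) (f : X -> Y),
    [/\ hausdorff_space Y, @second_countable Y, bijective f &
        forall A : set Y, measurable (f @^-1` A) <-> <<s (@open Y) >> A].

(* The acting group is only needed for G = Z^d, so it is an (additively
   written) abelian group; act g x is the point g . x. *)
Record pmp_action (G : zmodType) (R : realType) (disp : measure_display)
    (X : measurableType disp) (mu : probability X R) := PmpAction {
  act :> G -> X -> X;
  act0 : forall x, act 0 x = x;
  actD : forall g h x, act (g + h) x = act g (act h x);
  act_measurable : forall g, measurable_fun setT (act g);
  act_pres : forall g (A : set X), measurable A -> mu (act g @^-1` A) = mu A
}.

Definition essentially_free (G : zmodType) (R : realType)
    (disp : measure_display) (X : measurableType disp) (mu : probability X R)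
    (alpha : pmp_action G mu) : Prop :=
  \forall x \ae mu, forall g, alpha g x = x -> g = 0.

End StandardSpace.

Section LinftyZ.
Context (R : realType) (disp : measure_display) (X : measurableType disp)
  (mu : probability X R).

(* Z carries the discrete sigma-algebra, hence all preimages are required to
   be measurable. *)
Definition ess_bounded_int : {pred X -> int} := fun f =>
  `[< (forall A : set int, measurable (f @^-1` A)) /\
      (exists b : int, \forall x \ae mu, `|f x| <= b) >].

Lemma ess_bounded_int_closed : zmod_closed ess_bounded_int.
Proof.
split.
  apply/asboolP; split; last by exists 0; apply: nearW => x; rewrite normr0.
  move=> A; rewrite (_ : 0 = cst 0) // preimage_cst.
  by case: ifP => _; [exact: measurableT|exact: measurable0].
move=> f g /asboolP[mf [b fb]] /asboolP[mg [c gc]]; apply/asboolP; split.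
  move=> A.
  have -> : (f - g) @^-1` A = \bigcup_(k : int)
      (f @^-1` [set m | A (m - k)] `&` g @^-1` [set k]).
    apply/seteqP; split=> [x Ax|x [k _ [/= + gk]]]; last by rewrite -gk.
    by exists (g x).
  by apply: countable_bigcupT_measurable => // k; apply: measurableI.
exists (b + c); move: fb gc; apply: filterS2 => x fb gc.
by apply: (le_trans (ler_normB _ _)); exact: lerD.
Qed.

HB.instance Definition _ :=
  GRing.isZmodClosed.Build (X -> int) ess_bounded_int ess_bounded_int_closed.

Record linf_fun := LinfFun {
  linf_val :> X -> int;
  linf_valP : linf_val \in ess_bounded_int
}.

HB.instance Definition _ := [isSub for linf_val].
HB.instance Definition _ := gen_eqMixin linf_fun.
HB.instance Definition _ := gen_choiceMixin linf_fun.
HB.instance Definition _ :=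
  [SubChoice_isSubZmodule of linf_fun by <:].

Definition ae_zero : {pred linf_fun} := fun f => `[< \forall x \ae mu, f x = 0 >].

Lemma ae_zero_closed : zmod_closed ae_zero.
Proof.
split; first by apply/asboolP; apply: nearW.
move=> f g /asboolP f0 /asboolP g0; apply/asboolP.
by move: f0 g0; apply: filterS2 => x /= fx gx; rewrite -[LHS]/(f x - g x) fx gx subrr.
Qed.

HB.instance Definition _ :=
  GRing.isZmodClosed.Build linf_fun ae_zero ae_zero_closed.

Definition Linf := Quotient.quot ae_zero.
HB.instance Definition _ := GRing.Zmodule.on Linf.

(* The integral does not depend on the representative chosen by repr. *)
Definition linf_norm (f : Linf) : R := \int[mu]_x `|repr f x|%:~R.

Context (G : zmodType) (alpha : pmp_action G mu).

Lemma linf_act_subproof (f : linf_fun) (g : G) :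
  (fun x => f (alpha g x)) \in ess_bounded_int.
Proof.
have /asboolP[mf [b fb]] := linf_valP f; apply/asboolP; split.
  move=> A; rewrite -[X in measurable X]setTI.
  exact: (@act_measurable _ _ _ _ _ alpha g measurableT _ (mf A)).
exists b; case: fb => N [mN N0 fbN]; exists (alpha g @^-1` N); split.
- by rewrite -[X in measurable X]setTI; exact: act_measurable.
- by rewrite act_pres.
- by move=> x /= fbx; apply: fbN.
Qed.

(* The right action (f . g)(x) = f (g . x), computed on a representative. *)
Definition linf_act (f : Linf) (g : G) : Linf :=
  \pi_Linf (LinfFun (linf_act_subproof (repr f) g)).

End LinftyZ.

(* A (x)_{ZG} B for abelian groups A and B with a right, resp. left, action of
   G: the free abelian group on A * B modulo the subgroup generated by
   biadditivity and a.g (x) b - a (x) g.b.  Since ZG is additively generated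
   by G, balancedness over ZG amounts to balancedness over G. *)
Section Tensor.
Context (G : Type) (A B : zmodType) (ra : A -> G -> A) (la : G -> B -> B).

Inductive tensor_rel : {freeg (A * B)%type / int} -> Prop :=
| tensor_rel0 : tensor_rel 0
| tensor_relB x y : tensor_rel x -> tensor_rel y -> tensor_rel (x - y)
| tensor_relDl a a' b : tensor_rel (<< (a + a', b) >> - << (a, b) >> - << (a', b) >>)
| tensor_relDr a b b' : tensor_rel (<< (a, b + b') >> - << (a, b) >> - << (a, b') >>)
| tensor_relG a g b : tensor_rel (<< (ra a g, b) >> - << (a, la g b) >>).

Definition tensor_null : {pred {freeg (A * B)%type / int}} :=
  fun x => `[< tensor_rel x >].

Lemma tensor_null_closed : zmod_closed tensor_null.
Proof.
split; first by apply/asboolP; exact: tensor_rel0.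
by move=> x y /asboolP tx /asboolP ty; apply/asboolP; exact: tensor_relB.
Qed.

HB.instance Definition _ :=
  GRing.isZmodClosed.Build {freeg (A * B)%type / int} tensor_null
    tensor_null_closed.

Definition tensor := Quotient.quot tensor_null.
HB.instance Definition _ := GRing.Zmodule.on tensor.

Definition tens (a : A) (b : B) : tensor := \pi_tensor << (a, b) >>.

Lemma tensor_piP x y : \pi_tensor x = \pi_tensor y <-> tensor_rel (x - y).
Proof.
split=> [/eqP|xy]; first by rewrite -Quotient.idealrBE => /asboolP.
by apply/eqP; rewrite -Quotient.idealrBE; exact/asboolP.
Qed.

Lemma tensor_piD x y : \pi_tensor (x + y) = \pi_tensor x + \pi_tensor y.
Proof. by rewrite !piE. Qed.

Lemma tensDl a a' b : tens (a + a') b = tens a b + tens a' b.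
Proof.
by rewrite -tensor_piD; apply/tensor_piP; rewrite opprD addrA; exact: tensor_relDl.
Qed.

Lemma tensDr a b b' : tens a (b + b') = tens a b + tens a b'.
Proof.
by rewrite -tensor_piD; apply/tensor_piP; rewrite opprD addrA; exact: tensor_relDr.
Qed.

Lemma tensG a g b : tens (ra a g) b = tens a (la g b).
Proof. exact/tensor_piP/tensor_relG. Qed.

End Tensor.

(* id (x) h, computed on a representative; tensor_mapD and tensor_map_tens
   show that this is well defined when h is additive and G-equivariant. *)
Section TensorMap.
Context (G : Type) (A B B' : zmodType) (ra : A -> G -> A)
  (la : G -> B -> B) (la' : G -> B' -> B') (h : B -> B').

Definition tensor_map (x : tensor ra la) : tensor ra la' :=
  fglift (fun p : A * B => tens ra la' p.1 (h p.2) : zmodule (tensor ra la'))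
    (repr x).

Hypothesis hD : {morph h : b c / b + c}.
Hypothesis hG : forall g b, h (la g b) = la' g (h b).

Let lft (x : {freeg (A * B)%type / int}) : tensor ra la' :=
  fglift (fun p : A * B => tens ra la' p.1 (h p.2) : zmodule (tensor ra la')) x.

Let lftB : {morph lft : x y / x - y}.
Proof. exact: (@lift_is_additive int _ (zmodule (tensor ra la'))). Qed.

Let lftD : {morph lft : x y / x + y}.
Proof.
have lftN y : lft (- y) = - lft y.
  by rewrite -[in LHS]sub0r -(subrr y) !lftB subrr sub0r.
by move=> x y; rewrite -[y in LHS]opprK lftB lftN opprK.
Qed.

Let lftU a b : lft << (a, b) >> = tens ra la' a (h b).
Proof. by rewrite /lft liftU scale1r. Qed.

Let lft_rel x : tensor_rel ra la x -> lft x = 0.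
Proof.
have lft0 : lft 0 = 0 by rewrite -(subrr 0) lftB subrr.
elim=> [|{}x y _ IHx _ IHy|a a' b|a b b'|a g b].
- exact: lft0.
- by rewrite lftB IHx IHy subrr.
- by rewrite !lftB !lftU tensDl addrAC addrK subrr.
- by rewrite !lftB !lftU hD tensDr addrAC addrK subrr.
- by rewrite lftB !lftU hG tensG subrr.
Qed.

Let map_pi x : tensor_map (\pi_(tensor ra la) x) = lft x.
Proof.
rewrite /tensor_map -/(lft _); apply/eqP; rewrite -subr_eq0 -lftB.
by apply/eqP/lft_rel/tensor_piP; rewrite reprK.
Qed.

Lemma tensor_mapD : {morph tensor_map : x y / x + y}.
Proof.
move=> x y; rewrite -[x]reprK -[y]reprK -tensor_piD !map_pi.
exact: lftD.
Qed.

Lemma tensor_map_tens a b :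
  tensor_map (tens ra la a b) = tens ra la' a (h b).
Proof.
by rewrite /tens map_pi lftU.
Qed.

End TensorMap.

Section SingularChains.
Context (R : realType).

Definition std_simplex n : set 'rV[R]_n.+1 :=
  [set t | (forall i, 0 <= t 0 i) /\ \sum_i t 0 i = 1].
Arguments std_simplex : clear implicits.

(* The i-th face inclusion inserts the barycentric coordinate 0 at place i. *)
Definition face_pt n (i : 'I_n.+2) (t : 'rV[R]_n.+1) : 'rV[R]_n.+2 :=
  \row_j oapp (t 0) 0 (unlift i j).

Lemma face_pt_simplex n (i : 'I_n.+2) (t : std_simplex n) :
  std_simplex n.+1 (face_pt i (\val t)).
Proof.
have [t0 t1] := set_valP t; split=> [j|].
  by rewrite mxE; case: (unlift i j) => [k|] /=.
rewrite (bigD1_ord i) //= mxE unlift_none add0r -[RHS]t1.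
by apply: eq_bigr => k _; rewrite mxE liftK.
Qed.

Definition face_map n (i : 'I_n.+2) (t : std_simplex n) : std_simplex n.+1 :=
  SigSub (mem_set (face_pt_simplex i t)).

Lemma continuous_mx (S T : topologicalType) m n (f : S -> 'M[T]_(m, n)) (x : S) :
  (forall i j, {for x, continuous (fun y => f y i j)}) ->
  {for x, continuous f}.
Proof.
move=> cf U [P nP PU].
have : \forall y \near x, forall i j, P i j (f y i j).
  by apply: filter_forall => i; apply: filter_forall => j; exact: (cf i j _ (nP i j)).
by apply: filterS => y Py; apply: PU.
Qed.

Lemma continuous_entry (T : topologicalType) m n i j :
  continuous (fun M : 'M[T]_(m, n) => M i j).
Proof.
move=> M U nU; exists (fun i' j' => if (i' == i) && (j' == j) then U else setT).
  move=> i' j'; case: ifPn => [/andP[/eqP -> /eqP ->]//|_]; exact: filterT.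
by move=> N /(_ i j); rewrite !eqxx.
Qed.

Lemma face_map_continuous n (i : 'I_n.+2) : continuous (face_map i).
Proof.
apply: continuous_comp_initial => t.
apply: continuous_mx => k j.
rewrite /comp /= /prop_for.
have -> : (fun y : std_simplex n => (\val (face_map i y)) k j) =
          (fun y : std_simplex n => oapp ((\val y) 0) 0 (unlift i j)).
  by apply/funext => y; rewrite /= mxE.
case: (unlift i j) => [l|] /=; last exact: cst_continuous.
apply: (@continuous_comp _ _ _ (fun y : std_simplex n => \val y)
          (fun M : 'rV[R]_n.+1 => M 0 l)).
  exact: initial_continuous.
exact: continuous_entry.
Qed.

HB.instance Definition _ n (i : 'I_n.+2) :=
  isContinuous.Build _ _ (face_map i) (@face_map_continuous n i).

Definition sing (E : topologicalType) n := continuousType (std_simplex n) E.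
HB.instance Definition _ (E : topologicalType) n := Choice.on (sing E n).

Definition sing_chain (E : topologicalType) n := {freeg (sing E n) / int}.
HB.instance Definition _ (E : topologicalType) n :=
  GRing.Lmodule.on (sing_chain E n).

Definition sing_face (E : topologicalType) n (i : 'I_n.+2) (s : sing E n.+1) :
  sing E n := s \o face_map i.

Definition sing_push (E F : topologicalType) (f : continuousType E F) n
  (s : sing E n) : sing F n := f \o s.

Definition sing_bd (E : topologicalType) n :
    sing_chain E n.+1 -> sing_chain E n :=
  fglift (fun s : sing E n.+1 =>
    \sum_(i < n.+2) << (-1) ^+ i *g sing_face i s >> : sing_chain E n).

Definition chain_push (E F : topologicalType) (f : continuousType E F) n :
    sing_chain E n -> sing_chain F n :=
  fglift (fun s : sing E n => << sing_push f s >> : sing_chain F n).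

Lemma freeg_additive_eq (K : choiceType) (V : zmodType)
    (f g : {freeg K / int} -> V) :
  {morph f : x y / x - y} -> {morph g : x y / x - y} ->
  (forall k, f << k >> = g << k >>) -> f =1 g.
Proof.
move=> fB gB fg x.
pose F := GRing.isZmodMorphism.Build _ _ f fB.
pose Fm : {additive {freeg K / int} -> V} := HB.pack f F.
pose H := GRing.isZmodMorphism.Build _ _ g gB.
pose Hm : {additive {freeg K / int} -> V} := HB.pack g H.
rewrite -[f]/(Fm : _ -> _) -[g]/(Hm : _ -> _) -(freeg_sumE x) !raddf_sum.
apply: eq_bigr => k _; rewrite -[coeff k x]intz -freegU_mulz !raddfMz /=.
by rewrite fg.
Qed.

Lemma sing_bdB (E : topologicalType) n : {morph @sing_bd E n : x y / x - y}.
Proof. exact: lift_is_additive. Qed.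

Lemma chain_pushB (E F : topologicalType) (f : continuousType E F) n :
  {morph @chain_push E F f n : x y / x - y}.
Proof. exact: lift_is_additive. Qed.

HB.instance Definition _ (E : topologicalType) n :=
  GRing.isZmodMorphism.Build _ _ (@sing_bd E n) (@sing_bdB E n).
HB.instance Definition _ (E F : topologicalType) (f : continuousType E F) n :=
  GRing.isZmodMorphism.Build _ _ (@chain_push E F f n) (@chain_pushB E F f n).

Lemma sing_bdU (E : topologicalType) n (s : sing E n.+1) :
  sing_bd << s >> = \sum_(i < n.+2) << (-1) ^+ i *g sing_face i s >>.
Proof. by rewrite /sing_bd liftU scale1r. Qed.

Lemma chain_pushU (E F : topologicalType) (f : continuousType E F) n k
  (s : sing E n) : chain_push f << k *g s >> = << k *g sing_push f s >>.
Proof.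
rewrite /chain_push liftU; apply/eqP/freeg_eqP => t.
by rewrite coeffZ !coeffU mul1r.
Qed.

Lemma sing_bd_push (E F : topologicalType) (f : continuousType E F) n
    (c : sing_chain E n.+1) :
  sing_bd (chain_push f c) = chain_push f (sing_bd c).
Proof.
apply: (@freeg_additive_eq _ (sing_chain F n)
  (fun c => sing_bd (chain_push f c)) (fun c => chain_push f (sing_bd c))) => [x y|x y|s].
- by rewrite !raddfB.
- by rewrite !raddfB.
rewrite chain_pushU !sing_bdU raddf_sum; apply: eq_bigr => i _.
by rewrite /= chain_pushU; congr << _ *g _ >>; exact/continuousEP.
Qed.

End SingularChains.

Section Coverings.
Context (R : realType).

Definition simply_connected (E : topologicalType) : Prop :=
  [/\ [set: E] !=set0,
      forall x y : E, exists f : R -> E,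
        [/\ {within `[0, 1], continuous f}, f 0 = x & f 1 = y] &
      forall f : R -> E, {within `[0, 1], continuous f} -> f 0 = f 1 ->
        exists H : R * R -> E,
          {within `[0, 1] `*` `[0, 1], continuous H} /\
          (forall s, 0 <= s <= 1 ->
             [/\ H (s, 0) = f s, H (s, 1) = f 0, H (0, s) = f 0
               & H (1, s) = f 0])].

Definition evenly_covered (E M : topologicalType) (p : E -> M) (U : set M) :
    Prop :=
  exists (I : Type) (V : I -> set E) (s : I -> M -> E),
    [/\ forall i, open (V i), trivIset setT V, p @^-1` U = \bigcup_i V i &
        forall i, [/\ {within U, continuous (s i)}, U `<=` s i @^-1` V i,
                      {in U, cancel (s i) p} & {in V i, cancel p (s i)}]].

Definition covering_map (E M : topologicalType) (p : E -> M) : Prop :=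
  [/\ continuous p, set_surj setT setT p &
      forall m, exists U, [/\ open U, U m & evenly_covered p U]].

Definition deck_transformation (E M : topologicalType) (p : E -> M)
    (phi : E -> E) : Prop :=
  [/\ continuous phi, p \o phi = p &
      exists psi : E -> E, [/\ continuous psi, cancel phi psi & cancel psi phi]].

(* A simply connected covering of M together with an identification of G with
   its group of deck transformations, i.e. with the fundamental group of M. *)
Record universal_covering (G : zmodType) (M : topologicalType) :=
  UniversalCovering {
  cover : topologicalType;
  cover_proj : cover -> M;
  cover_covering : covering_map cover_proj;
  cover_simply_connected : simply_connected cover;
  deck : G -> continuousType cover cover;
  deck0 : forall x, deck 0 x = x;
  deckD : forall g h x, deck (g + h) x = deck g (deck h x);
  deckP : forall phi : cover -> cover,
    deck_transformation cover_proj phi <->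
    exists! g, deck g = phi :> (cover -> cover)
}.

End Coverings.

Section TwistedChains.
Context (R : realType) (G : zmodType) (M : topologicalType)
  (U : universal_covering R G M) (disp : measure_display)
  (X : measurableType disp) (mu : probability X R) (alpha : pmp_action G mu).

(* C_n(M; alpha), the tensor product over ZG of L^oo(X; Z) and of the singular
   n-chains of the universal covering. *)
Definition twisted_chain (n : nat) : zmodType :=
  tensor (linf_act alpha) (fun g : G => @chain_push R _ _ (deck U g) n).

Definition twisted_tens n (f : Linf mu) (c : sing_chain R (cover U) n) :
    twisted_chain n :=
  tens (linf_act alpha) (fun g : G => @chain_push R _ _ (deck U g) n) f c.

Definition twisted_bd n : twisted_chain n.+1 -> twisted_chain n :=
  tensor_map (fun g : G => @chain_push R _ _ (deck U g) n)
    (@sing_bd R (cover U) n).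

Lemma twisted_bdD n : {morph @twisted_bd n : x y / x + y}.
Proof.
apply: tensor_mapD => [x y|g x]; last exact: sing_bd_push.
exact: raddfD.
Qed.

Lemma twisted_bd_tens n (f : Linf mu) (c : sing_chain R (cover U) n.+1) :
  twisted_bd (twisted_tens f c) = twisted_tens f (sing_bd c).
Proof.
apply: tensor_map_tens => [x y|g x]; last exact: sing_bd_push.
exact: raddfD.
Qed.

(* The boundary operator of degree 0 is zero. *)
Definition twisted_cycle n : twisted_chain n -> Prop :=
  if n is m.+1 then fun c => twisted_bd (c : twisted_chain m.+1) = 0
  else fun=> True.

Definition null_homologous n (c : twisted_chain n) : Prop :=
  exists b : twisted_chain n.+1, twisted_bd b = c.

Definition same_orbit n (s t : sing R (cover U) n) : Prop :=
  exists g : G, t = sing_push (deck U g) s.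

(* r lists the pairs (f_j, sigma_j) of a reduced form of c. *)
Definition reduced_form n (c : twisted_chain n)
    (r : seq (Linf mu * sing R (cover U) n)) : Prop :=
  c = \sum_(p <- r) twisted_tens p.1 << p.2 >> /\
  pairwise (fun p q => `[< ~ same_orbit p.2 q.2 >]) r.

(* All reduced forms of c yield the same value. *)
Definition twisted_norm n (c : twisted_chain n) : R :=
  xget 0 [set v | exists2 r, reduced_form c r &
                             v = \sum_(p <- r) linf_norm p.1].

End TwistedChains.

Section Torus.
Context (R : realType).
Implicit Types (a t u : R).

(* S^1 is the unit circle in the plane.  The torus (S^1)^d has the universal
   covering t |-> (exp (2 i pi t_j))_j by R^d, whose deck transformations are
   the translations by Z^d. *)
Definition circle := set_type [set z : R * R | z.1 ^+ 2 + z.2 ^+ 2 = 1].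
HB.instance Definition _ := Topological.on circle.

Definition torus d : topologicalType := 'rV[circle]_d.

Lemma circle_pt_subproof t :
  [set z : R * R | z.1 ^+ 2 + z.2 ^+ 2 = 1] (cos (pi *+ 2 * t), sin (pi *+ 2 * t)).
Proof. exact: cos2Dsin2. Qed.

Definition circle_pt t : circle := SigSub (mem_set (circle_pt_subproof t)).

Definition torus_pt d (t : 'rV[R]_d) : torus d := map_mx circle_pt t.

Definition translate d (k : 'rV[int]_d) (t : 'rV[R]_d) : 'rV[R]_d :=
  t + map_mx intr k.

Let dot a (z : circle) : R :=
  cos (pi *+ 2 * a) * (\val z).1 + sin (pi *+ 2 * a) * (\val z).2.
Let cross a (z : circle) : R :=
  cos (pi *+ 2 * a) * (\val z).2 - sin (pi *+ 2 * a) * (\val z).1.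
Let angle a (z : circle) : R := a + asin (cross a z) / (pi *+ 2).

Let pi2_gt0 : 0 < pi *+ 2 :> R. Proof. by rewrite pmulrn_lgt0 ?pi_gt0. Qed.
Let pi2_neq0 : pi *+ 2 != 0 :> R. Proof. by rewrite gt_eqF. Qed.

Let dotE a t : dot a (circle_pt t) = cos (pi *+ 2 * (t - a)).
Proof. by rewrite /dot /= mulrBr cosB mulrC [sin _ * _]mulrC. Qed.

Let crossE a t : cross a (circle_pt t) = sin (pi *+ 2 * (t - a)).
Proof. by rewrite /cross /= mulrBr sinB mulrC [sin _ * _]mulrC. Qed.

Let dot2cross2 a z : dot a z ^+ 2 + cross a z ^+ 2 = 1.
Proof.
have /= z1 := set_valP z; have c1 := cos2Dsin2 (pi *+ 2 * a).
rewrite -[RHS]mulr1 -[in X in _ = X * _]c1 -z1 /dot /cross; ring.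
Qed.


Let perDint (f : R -> R) : periodic f (pi *+ 2) ->
  forall u (k : int), f (u + pi *+ 2 * k%:~R) = f u.
Proof.
move=> pf u [n|n]; first by rewrite -pmulrn mulr_natr periodicn.
rewrite NegzE mulrNz mulrN -pmulrn mulr_natr -[LHS](periodicn pf n.+1).
by rewrite subrK.
Qed.

Let circle_ptDint t (k : int) : circle_pt (t + k%:~R) = circle_pt t.
Proof.
apply: val_inj; rewrite /= mulrDr (perDint (@cosD2pi R)).
by rewrite (perDint (@sinD2pi R)).
Qed.

Let int_near t : exists k : int, -(1/2) <= t - k%:~R < 1/2.
Proof.
exists (Num.floor (t + 1/2)); have /andP[] := floor_itv (t + 1/2).
rewrite intrD /= => ? ?; lra.
Qed.

Let int_small (k : int) : `|k%:~R : R| < 1 -> k = 0.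
Proof.
rewrite -intr_norm (_ : 1 = 1%:~R) // ltr_int => k1.
by apply/eqP; rewrite -normr_eq0 -absz_eq0; case: k k1 => [[|]|].
Qed.

Let dot_near a z (k : int) t : z = circle_pt t -> `|t - a - k%:~R| < 1/4 ->
  0 < dot a z.
Proof.
move=> -> tk; rewrite dotE.
rewrite -(perDint (@cosD2pi R) _ (- k)) -mulrDr mulrNz.
apply: cos_gt0_pihalf; have := pi_gt0 R; move: tk; rewrite ltr_norml; nra.
Qed.

Let near_dot a t : 0 < dot a (circle_pt t) ->
  exists k : int, `|t - a - k%:~R| < 1/4.
Proof.
rewrite dotE; have [k kt] := int_near (t - a) => cgt0; exists k.
move: cgt0; rewrite -(perDint (@cosD2pi R) _ (- k)) -mulrDr mulrNz.
set v := t - a - k%:~R in kt *; have p0 := pi_gt0 R.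
rewrite !ltNge => /negP ngt; apply/negP => v14; apply: ngt.
have v12 : `|v| <= 1/2 by rewrite ler_norml; apply/andP; split; lra.
have -> : cos (pi *+ 2 * v) = cos (pi *+ 2 * `|v|).
  by case: (ger0P v) => // _; rewrite mulrN cosN.
rewrite (_ : _ * _ = (pi *+ 2 * `|v| - pi / 2) + pi / 2); last by rewrite subrK.
rewrite cosDpihalf oppr_le0; apply: sin_ge0_pi; nra.
Qed.

Let cross_itv a z : 0 < dot a z -> -1 < cross a z < 1.
Proof. by move=> d0; have := dot2cross2 a z => dc; apply/andP; split; nra. Qed.

Let angleK a z : 0 < dot a z -> circle_pt (angle a z) = z.
Proof.
move=> d0; have /andP[c1 c2] := cross_itv d0; have dc := dot2cross2 a z.
have c12 : -1 <= cross a z <= 1 by rewrite !ltW.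
have ca : cos (asin (cross a z)) = dot a z.
  by rewrite cos_asin// -dc addrK sqrtr_sqr gtr0_norm.
have sa : sin (asin (cross a z)) = cross a z by rewrite asinK.
apply: val_inj; rewrite /= /angle mulrDr mulrCA divff // mulr1 cosD sinD ca sa.
have := cos2Dsin2 (pi *+ 2 * a); rewrite /dot /cross.
move: (cos _) (sin _) => C S CS.
rewrite [RHS]surjective_pairing; congr pair.
  by transitivity ((C ^+ 2 + S ^+ 2) * (\val z).1); [ring|rewrite CS mul1r].
by transitivity ((C ^+ 2 + S ^+ 2) * (\val z).2); [ring|rewrite CS mul1r].
Qed.

Let angle_near a t (k : int) : `|t - a - k%:~R| < 1/4 ->
  angle a (circle_pt t) + k%:~R = t.
Proof.
move=> tk; rewrite /angle crossE -(perDint (@sinD2pi R) _ (- k)) -mulrDr mulrNz.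
rewrite sinK; first by rewrite mulrC mulKf //; ring.
rewrite in_itv /=; have := pi_gt0 R; move: tk; rewrite ltr_norml; nra.
Qed.

Let near_angle a z : 0 < dot a z -> `|angle a z - a| < 1/4.
Proof.
move=> d0; have /andP[c1 c2] := cross_itv d0.
have h1 : asin (cross a z) < pi / 2 by apply: asin_ltpi2; rewrite c2 ltW.
have h2 : - (pi / 2) < asin (cross a z) by apply: asin_gtNpi2; rewrite c1 ltW.
rewrite /angle addrAC subrr add0r normrM normfV (gtr0_norm pi2_gt0).
rewrite ltr_pdivrMr // ltr_norml; apply/andP; split; lra.
Qed.

Let circle_pt_surj z : exists t, circle_pt t = z.
Proof.
have /= z1 := set_valP z.
have z11 : -1 <= (\val z).1 <= 1.
  by apply/andP; split; have := sqr_ge0 (\val z).2; nra.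
have ze : 1 - (\val z).1 ^+ 2 = (\val z).2 ^+ 2 by lra.
have [z2|z2] := leP 0 (\val z).2.
  exists (acos (\val z).1 / (pi *+ 2)); apply: val_inj => /=.
  rewrite mulrC divfK // acosK // sin_acos // ze sqrtr_sqr.
  by rewrite ger0_norm // -surjective_pairing.
exists (- acos (\val z).1 / (pi *+ 2)); apply: val_inj => /=.
rewrite mulrC divfK // cosN sinN acosK // sin_acos //.
rewrite ze sqrtr_sqr.
by rewrite ltr0_norm // opprK -surjective_pairing.
Qed.

Let circle_pt_eq s t : circle_pt s = circle_pt t -> exists k : int, s = t + k%:~R.
Proof.
move=> st; have d0 : 0 < dot t (circle_pt s).
  by rewrite st dotE subrr mulr0 cos0.
have [k sk] := near_dot d0; exists k.
rewrite -[LHS](angle_near sk) st.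
by rewrite -[in RHS](@angle_near t t 0) ?addr0 // subrr subr0 normr0.
Qed.

Let circle_pt_continuous : continuous circle_pt.
Proof.
apply: continuous_comp_initial => t.
have mc : {for t, continuous (fun x : R => pi *+ 2 * x)}.
  by apply: continuousM; [exact: cst_continuous|].
exact: (cvg_pair (continuous_comp mc (@continuous_cos R _))
  (continuous_comp mc (@continuous_sin R _))).
Qed.

Let val1_continuous : continuous (fun z : circle => (\val z).1).
Proof.
move=> z; apply: (@continuous_comp _ _ _ (fun z : circle => \val z) fst).
  exact: initial_continuous.
exact: cvg_fst.
Qed.

Let val2_continuous : continuous (fun z : circle => (\val z).2).
Proof.
move=> z; apply: (@continuous_comp _ _ _ (fun z : circle => \val z) snd).
  exact: initial_continuous.
exact: cvg_snd.
Qed.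

Let dot_continuous a : continuous (dot a).
Proof.
move=> z; exact: (cvgD (cvgM (cvg_cst _) (@val1_continuous z))
  (cvgM (cvg_cst _) (@val2_continuous z))).
Qed.

Let angle_continuous a z : 0 < dot a z -> {for z, continuous (angle a)}.
Proof.
move=> d0.
have cc : {for z, continuous (cross a)}.
  exact: (cvgB (cvgM (cvg_cst _) (@val2_continuous z))
    (cvgM (cvg_cst _) (@val1_continuous z))).
have ca : {for z, continuous (asin \o cross a)}.
  apply: continuous_comp; first exact: cc.
  by apply: continuous_asin; exact: cross_itv.
exact: (cvgD (cvg_cst _) (cvgM ca (cvg_cst _))).
Qed.

Lemma torus_pt_continuous d : continuous (@torus_pt d).
Proof.
move=> t; apply: continuous_mx => i j.
have -> : (fun y : 'rV[R]_d => torus_pt y i j) = (fun y => circle_pt (y i j)).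
  by apply/funext => y; rewrite mxE.
apply: (@continuous_comp _ _ _ (fun y : 'rV[R]_d => y i j) circle_pt).
  exact: continuous_entry.
exact: circle_pt_continuous.
Qed.

Lemma torus_pt_translate d (k : 'rV[int]_d) (t : 'rV[R]_d) :
  torus_pt (translate k t) = torus_pt t.
Proof. by apply/matrixP => i j; rewrite !mxE circle_ptDint. Qed.

Lemma torus_pt_eq d (s t : 'rV[R]_d) :
  torus_pt s = torus_pt t -> exists k, s = translate k t.
Proof.
move=> st; have /choice[k kP] : forall j, exists k : int, s 0 j = t 0 j + k%:~R.
  by move=> j; apply: circle_pt_eq; move/matrixP : st => /(_ 0 j); rewrite !mxE.
by exists (\row_j k j); apply/rowP => j; rewrite !mxE.
Qed.

Lemma torus_pt_covering d : covering_map (@torus_pt d).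
Proof.
split; first exact: torus_pt_continuous.
  move=> z _; have /choice[t tP] : forall j, exists t, circle_pt t = z 0 j.
    by move=> j; exact: circle_pt_surj.
  by exists (\row_j t j) => //; apply/rowP => j; rewrite !mxE.
move=> z; have /choice[a aP] : forall j, exists t, circle_pt t = z 0 j.
  by move=> j; exact: circle_pt_surj.
pose U : set (torus d) := [set w | forall j, 0 < dot (a j) (w 0 j)].
have oU : open U.
  rewrite openE => w Uw.
  suff : \forall y \near w, forall j, 0 < dot (a j) ((y : torus d) 0 j) by [].
  apply: (@filter_forall (torus d) 'I_d
    (fun j y => 0 < dot (a j) (y 0 j)) (nbhs w)) => j.
  have cw : {for w, continuous (dot (a j) \o (fun w : torus d => w 0 j))}.
    apply: continuous_comp; first exact: continuous_entry.
    exact: dot_continuous.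
  apply: (cw [set x : R | 0 < x]); apply: open_nbhs_nbhs.
  by split; [exact: open_gt|exact: Uw].
exists U; split => //.
  by move=> j; rewrite -aP dotE subrr mulr0 cos0.
exists 'rV[int]_d.
exists (fun k : 'rV[int]_d => [set t : 'rV[R]_d | forall j, `|t 0 j - a j - (k 0 j)%:~R| < 1/4]).
exists (fun (k : 'rV[int]_d) (w : torus d) => \row_j (angle (a j) (w 0 j) + (k 0 j)%:~R)); split.
- move=> k; rewrite openE => t kt.
  suff : \forall y \near t, forall j,
      `|(y : 'rV[R]_d) 0 j - a j - (k 0 j)%:~R| < 1/4 by [].
  apply: (@filter_forall 'rV[R]_d 'I_d
    (fun j y => `|y 0 j - a j - (k 0 j)%:~R| < 1/4) (nbhs t)) => j.
  have ct : {for t, continuous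
      (fun t : 'rV[R]_d => `|t 0 j - a j - (k 0 j)%:~R|)}.
    exact: (cvg_norm (cvgB (cvgB (@continuous_entry _ _ _ 0 j t) (cvg_cst _))
      (cvg_cst _))).
  apply: (ct [set x : R | x < 1/4]); apply: open_nbhs_nbhs.
  by split; [exact: open_lt|exact: kt].
- move=> k k' _ _ [t [kt kt']]; apply/rowP => j; apply/eqP.
  rewrite -subr_eq0; apply/eqP/int_small; rewrite rmorphB /=.
  move: (kt j) (kt' j); rewrite !ltr_norml => /andP[? ?] /andP[? ?].
  by apply/andP; split; lra.
- apply/seteqP; split=> [t Ut|t [k _ kt] j]; last first.
    by apply: (dot_near _ (kt j)); rewrite mxE.
  have /choice[k kP] : forall j, exists k : int,
      `|t 0 j - a j - k%:~R| < 1/4.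
    by move=> j; apply: near_dot; have := Ut j; rewrite mxE.
  by exists (\row_j k j) => // j; rewrite mxE.
move=> k; split.
- apply: continuous_in_subspaceT => w /set_mem Uw.
  apply: continuous_mx => i j.
  have -> : (fun w : torus d => (\row_j (angle (a j) (w 0 j) + (k 0 j)%:~R)) i j)
     = (fun w : torus d => (angle (a j) \o (fun w : torus d => w 0 j)) w
          + (k 0 j)%:~R).
    by apply/funext => y; rewrite mxE.
  have ca : {for w, continuous (angle (a j) \o (fun w : torus d => w 0 j))}.
    apply: continuous_comp; first exact: continuous_entry.
    exact: angle_continuous.
  exact: (cvgD ca (cvg_cst _)).
- by move=> w Uw j; rewrite mxE addrAC addrK; exact: near_angle.
- move=> w /set_mem Uw; apply/rowP => j; rewrite !mxE circle_ptDint.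
  exact: angleK.
- move=> t /set_mem kt; apply/rowP => j; rewrite !mxE; exact: angle_near.
Qed.

Lemma translate0 d (t : 'rV[R]_d) : translate 0 t = t.
Proof. by apply/rowP => j; rewrite !mxE addr0. Qed.

Lemma translateD d (k l : 'rV[int]_d) (t : 'rV[R]_d) :
  translate (k + l) t = translate k (translate l t).
Proof. by apply/rowP => j; rewrite !mxE intrD addrA addrAC. Qed.

Lemma translate_continuous d (k : 'rV[int]_d) : continuous (translate k).
Proof.
move=> t; apply: continuous_mx => i j.
have -> : (fun y => translate k y i j) = (fun y => y i j + (k i j)%:~R).
  by apply/funext => y; rewrite !mxE.
exact: (cvgD (@continuous_entry _ _ _ i j t) (cvg_cst _)).
Qed.

HB.instance Definition _ d (k : 'rV[int]_d) :=
  isContinuous.Build _ _ (translate k) (@translate_continuous d k).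

Let int_valued_cst (f : R -> R) : continuous f ->
  (forall s, exists k : int, f s = k%:~R) -> f 0 = f 1.
Proof.
move=> cf fi; apply/eqP/negPn/negP => f01.
have [k kf] : exists k : int, Num.min (f 0) (f 1) <= k%:~R + 1/2
    <= Num.max (f 0) (f 1).
  have [[m fm] [n fn]] := (fi 0, fi 1).
  move: f01; rewrite fm fn eqr_int; case: (ltgtP m n) => // mn _.
    have mn1 : m%:~R + 1 <= n%:~R :> R.
      by rewrite (_ : 1 = 1%:~R) // -intrD ler_int -ltzD1 ltrD2r.
    by exists m; rewrite min_l ?max_r; [apply/andP; split|..]; lra.
  have nm1 : n%:~R + 1 <= m%:~R :> R.
    by rewrite (_ : 1 = 1%:~R) // -intrD ler_int -ltzD1 ltrD2r.
  by exists n; rewrite min_r ?max_l; [apply/andP; split|..]; lra.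
have [c _ fc] := IVT ler01 (continuous_subspaceT cf) kf.
have [l fl] := fi c.
have lk : (l - k)%:~R = 1/2 :> R by rewrite intrB -fl fc; lra.
have lk0 : l - k = 0 by apply: int_small; rewrite lk ltr_norml; lra.
by move: lk; rewrite lk0; lra.
Qed.

Lemma torus_deckP d (phi : 'rV[R]_d -> 'rV[R]_d) :
  deck_transformation (@torus_pt d) phi <->
  exists! k, translate k = phi.
Proof.
split=> [[cphi pphi _]|[k [<- _]]]; last first.
  split; first exact: translate_continuous.
    by apply/funext => t; exact: torus_pt_translate.
  exists (translate (- k)); split; first exact: translate_continuous.
    by move=> t; rewrite -translateD addNr translate0.
  by move=> t; rewrite -translateD addrN translate0.
have kE (t : 'rV[R]_d) : exists k, phi t = translate k t.
  by apply: torus_pt_eq; rewrite -[LHS]/((@torus_pt d \o phi) t) pphi.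
have [k k0] := kE 0; exists k; split; last first.
  move=> k' /(congr1 (fun f => f 0)); rewrite k0 => /rowP kk; apply/rowP => j.
  by have := kk j; rewrite !mxE !add0r => /intr_inj.
apply/funext => t; apply/rowP => j.
pose f (s : R) := phi (s *: t) 0 j - s * t 0 j.
have cf : continuous f.
  move=> s.
  have cst_ : {for s, continuous (fun s : R => s *: t)}.
    apply: continuous_mx => i j'.
    have -> : (fun s : R => (s *: t) i j') = (fun s : R => s * t i j').
      by apply/funext => s'; rewrite mxE.
    exact: (cvgM cvg_id (cvg_cst _)).
  have c2 : {for s, continuous (phi \o (fun s : R => s *: t))}.
    by apply: continuous_comp; [exact: cst_|exact: cphi].
  have c3 : {for s, continuous
      ((fun M : 'rV[R]_d => M 0 j) \o (phi \o (fun s : R => s *: t)))}.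
    by apply: continuous_comp; [exact: c2|exact: continuous_entry].
  exact: (cvgB c3 (cvgM cvg_id (cvg_cst _))).
have fi s : exists l : int, f s = l%:~R.
  have [l lE] := kE (s *: t); exists (l 0 j).
  by rewrite /f lE !mxE addrAC subrr add0r.
have := int_valued_cst cf fi; rewrite /f scale0r scale1r mul0r mul1r subr0 k0.
by rewrite !mxE add0r => ->; rewrite addrC subrK.
Qed.

Lemma rV_simply_connected d : simply_connected R 'rV[R]_d.
Proof.
have lin (S : topologicalType) (f g : S -> R) (u v : S -> 'rV[R]_d) (x : S) :
    {for x, continuous f} -> {for x, continuous g} ->
    {for x, continuous u} -> {for x, continuous v} ->
    {for x, continuous (fun s => f s *: u s + g s *: v s)}.
  move=> cf cg cu cv; apply: continuous_mx => i j.
  have -> : (fun s => (f s *: u s + g s *: v s) i j) =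
      (fun s => f s * ((fun M : 'rV[R]_d => M i j) \o u) s +
                g s * ((fun M : 'rV[R]_d => M i j) \o v) s).
    by apply/funext => s; rewrite !mxE.
  have cu' : {for x, continuous ((fun M : 'rV[R]_d => M i j) \o u)}.
    by apply: continuous_comp; [exact: cu|exact: continuous_entry].
  have cv' : {for x, continuous ((fun M : 'rV[R]_d => M i j) \o v)}.
    by apply: continuous_comp; [exact: cv|exact: continuous_entry].
  exact: (cvgD (cvgM cf cu') (cvgM cg cv')).
split; first by exists 0.
  move=> x y; exists (fun s => (1 - s) *: x + s *: y); split.
  - apply: continuous_subspaceT => s.
    apply: (lin R (fun s => 1 - s) id (cst x) (cst y)); try exact: cvg_cst.
      exact: (cvgB (cvg_cst _) cvg_id).
    exact: cvg_id.
  - by rewrite subr0 scale1r scale0r addr0.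
  - by rewrite subrr scale1r scale0r add0r.
move=> f cf f01.
exists (fun p => (1 - p.2) *: f p.1 + p.2 *: f 0); split; last first.
  move=> s s01; split => /=.
  - by rewrite subr0 scale1r scale0r addr0.
  - by rewrite subrr scale1r scale0r add0r.
  - by rewrite -scalerDl subrK scale1r.
  - by rewrite -f01 -scalerDl subrK scale1r.
set Q := _ `*` _.
have c2 : {within Q, continuous (fun p : R * R => p.2)}.
  by apply: continuous_subspaceT => p; exact: cvg_snd.
have cf1 : {within Q, continuous (fun p : R * R => f p.1)}.
  apply/subspace_continuousP => -[s t] [/= s01 t01] B nB.
  have /subspace_continuousP/(_ s s01 B nB) := cf.
  rewrite /nbhs /= /within /= => nf.
  exists ([set x | `[0, 1]%classic x -> B (f x)], setT).
    by split => //=; exact: filterT.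
  by move=> [x y] [/= Bx _] [Qx _]; exact: Bx.
move=> p; apply: (lin (subspace Q) (fun p => 1 - p.2) (fun p => p.2)
  (fun p => f p.1) (cst (f 0))).
- exact: (cvgB (cvg_cst _) (c2 p)).
- exact: c2.
- exact: cf1.
- exact: cvg_cst.
Qed.

Definition torus_covering d : universal_covering R 'rV[int]_d (torus d) :=
  @UniversalCovering R _ _ _ _ (@torus_pt_covering d) (@rV_simply_connected d)
    (fun k => translate k) (@translate0 d) (@translateD d) (@torus_deckP d).

End Torus.

(* Main.v *)
From Pilot Require Import Defs.
From HB Require Import structures.
From mathcomp Require Import all_boot all_order all_algebra.
From mathcomp Require Import generic_quotient ring_quotient freeg.
From mathcomp Require Import zify ring lra.
From mathcomp Require Import all_classical all_reals all_analysis measurable_realfun.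

Set Implicit Arguments.
Unset Strict Implicit.
Unset Printing Implicit Defensive.

Import Order.TTheory GRing.Theory Num.Theory.
Import numFieldNormedType.Exports.
(* The covering space [cover] prevails over its homonyms in finset and
   classical_sets. *)
Import Pilot.Defs.

Local Open Scope classical_set_scope.
Local Open Scope ring_scope.
Local Open Scope quotient_scope.

(** The constant K = 2 works in every degree. Let c be the boundary of
    b = sum_j f_j (x) s_j. Inside R^d every boundary can be filled without
    increasing the norm, by coning it from the origin (sing_bd_cone). The cone is
    not invariant under Z^d, so it does not act on twisted chains; but it can be
    applied after breaking the symmetry, that is after choosing for each point x
    of X a translate of R^d.

    Such a choice is a measurable map gamma : X -> Z^d with finitely many values,
    to be read as the displacement from x to the centre of a tile of its orbit.
    The term f (x) s is cut into the pieces f_g on which gamma = g, and f_g (x) s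
    is rewritten as (f_g . g^-1) (x) g s. Coning the boundary of every piece gives
    a new chain (fill) whose boundary is again c (fill_bd).

    Its norm is estimated in fill_norm. If gamma were equivariant, that is
    gamma (k x) + k = gamma x for all k, the faces would cancel in the new chain
    exactly as they cancel in c, and the norm would be at most |c|. In general
    only the finitely many k that relate the faces of the s_j to representatives
    of their orbits matter, and a failure for k costs at most the measure of the
    set of points where the identity fails for k, times a constant that depends
    on b only. Since b is fixed before gamma is chosen, this error can be made
    smaller than |c| as soon as |c| > 0, and c = 0 has the filling 0.

    It remains to find maps gamma with small failure sets, a form of the Rokhlin
    lemma for free actions of Z^d (approximate_coboundary). As the action is
    essentially free on a standard Borel space, finitely many sets that are
    disjoint from their translates under a given large ball cover X up to a
    small error (spread_cover). Each of them in turn serves as a set of centres: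
    balls around the centres are carved out of what is left of X, with a radius
    at which the boundary is small compared to the volume (tiling_carve). Such a
    radius exists because Z^d has polynomial growth, whereas the volume would
    grow exponentially if the boundary were always large.

    The norm of a twisted chain is computed from any presentation with the help
    of an equivariant map from singular simplices to Z^d, the integer part of the
    initial vertex: it selects a representative in every orbit, and the
    coefficients with respect to the representatives do not depend on the
    presentation (twisted_normE). *)

(** * Essentially bounded integer-valued functions *)

Section Linf.
Context (R : realType) (disp : measure_display) (X : measurableType disp)
  (mu : probability X R).
Implicit Types (f : linf_fun mu) (u v : Linf mu).

Definition linf_class f : Linf mu := \pi_(Linf mu) f.

Lemma linf_fun_measurable f (A : set int) : measurable (f @^-1` A).
Proof. by have /asboolP[] := linf_valP f. Qed.

Lemma linf_fun_bounded f :
  exists2 b : R, 0 <= b & \forall x \ae mu, `|f x|%:~R <= b.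
Proof.
have /asboolP[_ [b fb]] := linf_valP f; exists (`|b|%:~R).
  by rewrite ler0z.
apply: filterS fb => x fx; rewrite ler_int.
exact: le_trans fx (ler_norm _).
Qed.

Lemma linf_fun_measurableR f (h : int -> R) :
  measurable_fun setT (fun x => h (f x)).
Proof.
move=> _ B mB; rewrite setTI.
exact: (linf_fun_measurable f (h @^-1` B)).
Qed.

Lemma linf_classP f (f' : linf_fun mu) :
  linf_class f = linf_class f' <-> \forall x \ae mu, f x = f' x.
Proof.
split=> [/eqP|fg].
  rewrite -Quotient.idealrBE => /asboolP; apply: filterS => x /eqP.
  by rewrite -[X in X == 0]/(f x - f' x) subr_eq0 => /eqP.
apply/eqP; rewrite -Quotient.idealrBE; apply/asboolP.
by apply: filterS fg => x fg; rewrite -[LHS]/(f x - f' x) fg subrr.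
Qed.

Lemma linf_classD f (f' : linf_fun mu) : linf_class (f + f') = linf_class f + linf_class f'.
Proof. by rewrite /linf_class !piE. Qed.

Lemma linf_class0 : linf_class 0 = 0.
Proof. by rewrite /linf_class !piE. Qed.

Lemma linf_class_sum (I : Type) (r : seq I) (P : pred I) (F : I -> linf_fun mu) :
  linf_class (\sum_(i <- r | P i) F i) = \sum_(i <- r | P i) linf_class (F i).
Proof. exact: (big_morph linf_class linf_classD linf_class0). Qed.

Lemma linf_funD f (f' : linf_fun mu) x : (f + f') x = f x + f' x.
Proof. by []. Qed.

Lemma linf_funMn f m x : (f *+ m) x = f x *+ m.
Proof. by elim: m => // m IHm; rewrite !mulrS linf_funD IHm. Qed.

Lemma linf_fun_sum (I : Type) (r : seq I) (P : pred I) (F : I -> linf_fun mu) x :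
  (\sum_(i <- r | P i) F i) x = \sum_(i <- r | P i) F i x.
Proof. by apply: (big_morph (fun f : linf_fun mu => f x)). Qed.

Lemma linf_classK u : linf_class (repr u) = u.
Proof. exact: reprK. Qed.

Lemma measurable_linf_abs f :
  measurable_fun setT (fun x => (`|f x|%:~R : R)%:E).
Proof. exact/measurable_EFinP/(linf_fun_measurableR f (fun k => `|k|%:~R)). Qed.

(** The norm of a class is the integral of any representative; all norm
    computations below are made on representatives through this identity. *)
Lemma linf_norm_class f :
  (linf_norm (linf_class f))%:E = (\int[mu]_x (`|f x|%:~R)%:E)%E.
Proof.
have mR := measurable_linf_abs.
rewrite /linf_norm /Rintegral fineK.
  apply: ge0_ae_eq_integral => //.
  have /linf_classP : linf_class (repr (linf_class f)) = linf_class f.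
    exact: linf_classK.
  by move=> [N [mN N0 sN]]; exists N; split => // x /= xN; apply: sN => /= fx;
    apply: xN => _; rewrite fx.
have [b b0 fb] := linf_fun_bounded (repr (linf_class f)).
apply/fin_numPlt/andP; split.
  apply: (@lt_le_trans _ _ 0%E); first exact: ltNyr.
  by apply: integral_ge0 => x _; rewrite lee_fin ler0z.
apply: (@le_lt_trans _ _ (\int[mu]_x (cst b%:E x))%E).
  apply: ae_ge0_le_integral => //.
    by apply: filterS fb => x fx _; rewrite lee_fin.
rewrite integral_cst //.

have -> : (b%:E * mu [set: X] = b%:E)%E by have := @probability_setT _ _ _ mu => ->; rewrite mule1.
exact: ltry.
Qed.

Lemma linf_norm_ge0 u : 0 <= linf_norm u.
Proof.
rewrite -(linf_classK u) -lee_fin linf_norm_class.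
by apply: integral_ge0 => x _; rewrite lee_fin ler0z.
Qed.

Lemma linf_norm0 : linf_norm (0 : Linf mu) = 0.
Proof.
apply: EFin_inj; rewrite -linf_class0 linf_norm_class.
by under eq_integral do rewrite /= normr0; rewrite integral0.
Qed.

Lemma linf_norm_eq0 u : linf_norm u = 0 -> u = 0.
Proof.
rewrite -(linf_classK u) => nu0.
have n0 : (\int[mu]_x (`|repr u x|%:~R)%:E = 0 :> \bar R)%E.
  by rewrite -linf_norm_class nu0.
rewrite -linf_class0; apply: (linf_classP _ _).2.
have [+ _] := @ae_eq_integral_abs _ _ _ mu setT measurableT _
  (measurable_linf_abs (repr u)).
case; first by rewrite -[RHS]n0; apply: eq_integral => x _; rewrite /= ger0_norm // ler0z.
move=> N [mN N0 sN]; exists N; split => // x xN; apply: sN => /=.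
by apply: contra_not xN => /(_ I)[] /eqP; rewrite intr_eq0 normr_eq0 => /eqP.
Qed.

Lemma ler_linf_normD u v : linf_norm (u + v) <= linf_norm u + linf_norm v.
Proof.
rewrite -(linf_classK u) -(linf_classK v) -linf_classD -lee_fin EFinD.
rewrite !linf_norm_class -ge0_integralD //; try exact: measurable_linf_abs.
apply: ge0_le_integral => //; try exact: measurable_linf_abs.
  by apply: emeasurable_funD; exact: measurable_linf_abs.
by move=> x _; rewrite -EFinD lee_fin -intrD ler_int ler_normD.
Qed.

Lemma ler_linf_norm_sum (I : Type) (r : seq I) (P : pred I) (F : I -> Linf mu) :
  linf_norm (\sum_(i <- r | P i) F i) <= \sum_(i <- r | P i) linf_norm (F i).
Proof.
elim/big_ind2: _ => [|u a v b ua vb|//]; first by rewrite linf_norm0.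
by apply: le_trans (ler_linf_normD _ _) _; exact: lerD.
Qed.

Context (G : zmodType) (alpha : pmp_action G mu).

Definition linf_shift f (g : G) : linf_fun mu :=
  LinfFun (linf_act_subproof alpha f g).

Lemma linf_shiftE f g x : linf_shift f g x = f (alpha g x).
Proof. by []. Qed.

Lemma ae_act (P : set X) (g : G) :
  (\forall x \ae mu, P x) -> \forall x \ae mu, P (alpha g x).
Proof.
case=> N [mN N0 PN]; exists (alpha g @^-1` N); split.
- by rewrite -[X in measurable X]setTI; exact: act_measurable.
- by rewrite act_pres.
- by move=> x /= Px; exact: PN.
Qed.

Lemma linf_act_class f (g : G) :
  linf_act alpha (linf_class f) g = linf_class (linf_shift f g).
Proof.
apply/linf_classP.
have /linf_classP ff : linf_class (repr (linf_class f)) = linf_class f.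
  exact: linf_classK.
exact: (ae_act g ff).
Qed.

Lemma linf_actDl u v g :
  linf_act alpha (u + v) g = linf_act alpha u g + linf_act alpha v g.
Proof.
rewrite -(linf_classK u) -(linf_classK v) -linf_classD !linf_act_class -linf_classD.
exact/linf_classP/nearW.
Qed.

Lemma linf_act0 u : linf_act alpha u 0 = u.
Proof.
rewrite -(linf_classK u) linf_act_class; apply/linf_classP/nearW => x.
by rewrite linf_shiftE act0.
Qed.

Lemma linf_actA u g h :
  linf_act alpha (linf_act alpha u g) h = linf_act alpha u (g + h).
Proof.
rewrite -(linf_classK u) !linf_act_class; apply/linf_classP/nearW => x.
by rewrite !linf_shiftE actD.
Qed.

Lemma act_integral (h : X -> \bar R) (g : G) :
  measurable_fun setT h -> (forall x, 0 <= h x)%E ->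
  (\int[mu]_x h (alpha g x) = \int[mu]_x h x)%E.
Proof.
move=> mh h0; have ma := @act_measurable _ _ _ _ _ alpha g.
transitivity (\int[pushforward mu (alpha g)]_x h x)%E.
  by rewrite ge0_integral_pushforward // preimage_setT.
by apply: eq_measure_integral => A mA _; exact: act_pres.
Qed.

Lemma linf_norm_act u g : linf_norm (linf_act alpha u g) = linf_norm u.
Proof.
rewrite -(linf_classK u) linf_act_class; apply: EFin_inj; rewrite !linf_norm_class.
apply: (@act_integral (fun x => (`|repr u x|%:~R)%:E) g) => [|x].
  exact: measurable_linf_abs.
by rewrite lee_fin ler0z.
Qed.

End Linf.

(** * Additive maps and tensor products *)

Lemma subr_morph_addr (V W : zmodType) (f : V -> W) :
  {morph f : x y / x - y} -> {morph f : x y / x + y}.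
Proof.
move=> fB x y; have f0 : f 0 = 0 by rewrite -[X in f X](subrr 0) fB subrr.
by rewrite -[y in LHS]opprK fB -[- y]sub0r fB f0 sub0r opprK.
Qed.

Section AdditiveMorphisms.
Context (V W : zmodType) (f : V -> W) (fD : {morph f : x y / x + y}).

Lemma additive_morph0 : f 0 = 0.
Proof. by apply: (addrI (f 0)); rewrite -fD !addr0. Qed.

Lemma additive_morphN x : f (- x) = - f x.
Proof. by apply/eqP; rewrite -addr_eq0 -fD addNr additive_morph0. Qed.

Lemma additive_morph_sum (I : Type) (r : seq I) (P : pred I) (F : I -> V) :
  f (\sum_(i <- r | P i) F i) = \sum_(i <- r | P i) f (F i).
Proof. exact: (big_morph f fD additive_morph0). Qed.

Lemma additive_morphMz x (k : int) : f (x *~ k) = f x *~ k.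
Proof.
have fMn y m : f (y *+ m) = f y *+ m.
  by elim: m => [|m IHm]; rewrite ?mulr0n ?additive_morph0 // !mulrS fD IHm.
case: k => m; first by rewrite -!pmulrn.
by rewrite NegzE !mulrNz -!pmulrn additive_morphN fMn.
Qed.

End AdditiveMorphisms.

Section Tensor.
Context (G : Type) (A B : zmodType) (ra : A -> G -> A) (la : G -> B -> B).
Local Notation "a \ox b" := (tens ra la a b) (at level 40).

Lemma tens_sumr (I : Type) (r : seq I) (P : pred I) (F : I -> B) a :
  a \ox (\sum_(i <- r | P i) F i) = \sum_(i <- r | P i) a \ox F i.
Proof. exact/additive_morph_sum/tensDr. Qed.

Lemma tens_suml (I : Type) (r : seq I) (P : pred I) (F : I -> A) b :
  (\sum_(i <- r | P i) F i) \ox b = \sum_(i <- r | P i) F i \ox b.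
Proof. by apply: (@additive_morph_sum _ _ (fun a => a \ox b)) => a a'; exact: tensDl. Qed.

Lemma tens0l b : 0 \ox b = 0.
Proof. by apply: (@additive_morph0 _ _ (fun a => a \ox b)) => a a'; exact: tensDl. Qed.

Lemma tensMz a b (k : int) : a \ox (b *~ k) = (a *~ k) \ox b.
Proof.
rewrite (additive_morphMz (tensDr ra la a)).
by rewrite (@additive_morphMz _ _ (fun a => a \ox b)) // => ? ?; exact: tensDl.
Qed.

Lemma tensor_ind (P : tensor ra la -> Prop) :
  P 0 -> (forall x y, P x -> P y -> P (x + y)) -> (forall a b, P (a \ox b)) ->
  forall x, P x.
Proof.
move=> P0 PD Pt x; rewrite -[x]reprK -(freeg_sumE (repr x)).
rewrite (additive_morph_sum (@tensor_piD _ _ _ ra la)).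
apply: (big_ind P) => // -[a b] _.
rewrite -[coeff _ _]intz -freegU_mulz.
rewrite (additive_morphMz (@tensor_piD _ _ _ ra la)) -/(a \ox b).
rewrite -(@additive_morphMz _ _ (fun a => a \ox b)) => [|? ?]; last exact: tensDl.
exact: Pt.
Qed.

Context (C : zmodType) (phi : A -> B -> C).

(** The map out of the tensor product that its universal property attaches
    to a balanced biadditive phi, computed on a representative. *)
Definition tensor_lift (x : tensor ra la) : C :=
  fglift (fun p : A * B => phi p.1 p.2 : zmodule C) (repr x).

Hypothesis phiDl : forall b, {morph phi^~ b : a a' / a + a'}.
Hypothesis phiDr : forall a, {morph phi a : b b' / b + b'}.
Hypothesis phiG : forall a g b, phi (ra a g) b = phi a (la g b).

Let lft (x : {freeg (A * B)%type / int}) : C :=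
  fglift (fun p : A * B => phi p.1 p.2 : zmodule C) x.

Let lftB : {morph lft : x y / x - y}.
Proof. exact: (@lift_is_additive int _ (zmodule C)). Qed.

Let lft0 : lft 0 = 0. Proof. by rewrite -[X in lft X](subrr 0) lftB subrr. Qed.

Let lftU a b : lft << (a, b) >> = phi a b.
Proof. by rewrite /lft liftU scale1r. Qed.

Let lft_rel x : tensor_rel ra la x -> lft x = 0.
Proof.
elim=> [|{}x y _ IHx _ IHy|a a' b|a b b'|a g b].
- exact: lft0.
- by rewrite lftB IHx IHy subrr.
- by rewrite !lftB !lftU phiDl addrAC addrK subrr.
- by rewrite !lftB !lftU phiDr addrAC addrK subrr.
- by rewrite lftB !lftU phiG subrr.
Qed.

Let lift_pi x : tensor_lift (\pi_(tensor ra la) x) = lft x.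
Proof.
rewrite /tensor_lift -/(lft _); apply/eqP; rewrite -subr_eq0 -lftB.
by apply/eqP/lft_rel/tensor_piP; rewrite reprK.
Qed.

Lemma tensor_liftD : {morph tensor_lift : x y / x + y}.
Proof.
move=> x y; rewrite -[x]reprK -[y]reprK -tensor_piD !lift_pi.
exact: subr_morph_addr.
Qed.

Lemma tensor_lift_tens a b : tensor_lift (a \ox b) = phi a b.
Proof. by rewrite /tens lift_pi lftU. Qed.

End Tensor.

Section SeqSums.
Context (I : eqType) (V : zmodType).

Lemma big_uniq_supp (S T : seq I) (F : I -> V) : uniq S -> uniq T ->
  {subset S <= T} -> (forall i, i \notin S -> F i = 0) ->
  \sum_(i <- T) F i = \sum_(i <- S) F i.
Proof.
move=> uS uT ST F0; rewrite (bigID (mem S)) /= [X in _ + X]big1 ?addr0 //.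
rewrite -big_filter; apply/perm_big/uniq_perm; rewrite ?filter_uniq // => i.
by rewrite mem_filter; case: (boolP (i \in S)) => //= iS; rewrite ST.
Qed.

Lemma big_uniq_if (T : seq I) (i : I) (F : I -> V) : uniq T -> i \in T ->
  \sum_(j <- T) (if i == j then F j else 0) = F i.
Proof.
move=> uT iT; rewrite (bigD1_seq i) //= eqxx big1 ?addr0 // => j.
by rewrite eq_sym => /negPf ->.
Qed.

End SeqSums.

(** * Reduced forms and the norm of a twisted chain *)

Section TwistedNorm.
Context (R : realType) (G : zmodType) (M : topologicalType)
  (U : universal_covering R G M) (disp : measure_display)
  (X : measurableType disp) (mu : probability X R) (alpha : pmp_action G mu).
Implicit Types (f u : Linf mu) (g h : G).

Lemma sing_push0 n (s : sing R (cover U) n) : sing_push (deck U 0) s = s.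
Proof. by apply/continuousEP => x /=; rewrite deck0. Qed.

Lemma sing_pushD n (s : sing R (cover U) n) g h :
  sing_push (deck U (g + h)) s = sing_push (deck U g) (sing_push (deck U h) s).
Proof. by apply/continuousEP => x /=; rewrite deckD. Qed.

(* An equivariant map pos from the n-simplices to G witnesses that G acts freely
   on them; its fibre over 0 is a set of representatives of the orbits. *)
Context (n : nat) (pos : sing R (cover U) n -> G).
Hypothesis pos_push : forall s g, pos (sing_push (deck U g) s) = g + pos s.
Implicit Types (s t : sing R (cover U) n) (c : twisted_chain U alpha n)
  (r : seq (Linf mu * sing R (cover U) n)).

Definition orbit_rep s := sing_push (deck U (- pos s)) s.

Lemma orbit_rep_push s g : orbit_rep (sing_push (deck U g) s) = orbit_rep s.
Proof. by rewrite /orbit_rep -sing_pushD pos_push opprD addrAC addNr add0r. Qed.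

Lemma push_orbit_rep s : sing_push (deck U (pos s)) (orbit_rep s) = s.
Proof. by rewrite -sing_pushD addrN sing_push0. Qed.

Lemma orbit_repK s : orbit_rep (orbit_rep s) = orbit_rep s.
Proof. exact: orbit_rep_push. Qed.

Lemma same_orbitP s t : same_orbit s t <-> orbit_rep s = orbit_rep t.
Proof.
split=> [[g ->]|st]; first by rewrite orbit_rep_push.
by exists (pos t - pos s); rewrite sing_pushD -/(orbit_rep s) st push_orbit_rep.
Qed.

Let rep_in r p : p \in r -> orbit_rep p.2 \in [seq orbit_rep p.2 | p <- r].
Proof. by move=> pr; apply/mapP; exists p. Qed.

(** The coefficient of f (x) z at the orbit of t, where t is its own
    representative: moving s = pos s . t over to t multiplies f by pos s. *)
Definition coef_tens t f (z : sing_chain R (cover U) n) : Linf mu :=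
  fglift (fun s => (if orbit_rep s == t then linf_act alpha f (pos s) else 0)
    : zmodule (Linf mu)) z.

Let coef_tensB t f : {morph coef_tens t f : x y / x - y}.
Proof. exact: (@lift_is_additive int _ (zmodule (Linf mu))). Qed.

Let coef_tensD t f : {morph coef_tens t f : x y / x + y}.
Proof. exact/subr_morph_addr/coef_tensB. Qed.

Let coef_tensU t f s : coef_tens t f << s >> =
  if orbit_rep s == t then linf_act alpha f (pos s) else 0.
Proof. by rewrite /coef_tens liftU scale1r. Qed.

Definition coef t : twisted_chain U alpha n -> Linf mu :=
  tensor_lift (coef_tens t).

Let coef_tensDl t z : {morph (coef_tens t)^~ z : f u / f + u}.
Proof.
move=> f u; apply: (@freeg_additive_eq _ _ (coef_tens t (f + u))
  (fun z => coef_tens t f z + coef_tens t u z)) => [x y|x y|s].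
- exact: coef_tensB.
- by rewrite !coef_tensB opprD addrACA.
- by rewrite !coef_tensU; case: ifP => _; rewrite ?addr0 // linf_actDl.
Qed.

Let coef_tensG t f g z : coef_tens t (linf_act alpha f g) z =
  coef_tens t f (chain_push (deck U g) z).
Proof.
apply: (@freeg_additive_eq _ _ (coef_tens t (linf_act alpha f g))
  (fun z => coef_tens t f (chain_push (deck U g) z))) => [x y|x y|s].
- exact: coef_tensB.
- by rewrite raddfB coef_tensB.
- by rewrite chain_pushU !coef_tensU orbit_rep_push pos_push linf_actA.
Qed.

Lemma coefD t : {morph coef t : c c' / c + c'}.
Proof. exact: tensor_liftD (coef_tensDl t) (coef_tensD t) (coef_tensG t). Qed.

Lemma coef_tensE t f s : coef t (twisted_tens alpha f << s >>) =
  if orbit_rep s == t then linf_act alpha f (pos s) else 0.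
Proof.
rewrite /coef /twisted_tens.
by rewrite (tensor_lift_tens (coef_tensDl t) (coef_tensD t) (coef_tensG t)) coef_tensU.
Qed.

Lemma coef_sum t r : coef t (\sum_(p <- r) twisted_tens alpha p.1 << p.2 >>) =
  \sum_(p <- r) if orbit_rep p.2 == t then linf_act alpha p.1 (pos p.2) else 0.
Proof.
rewrite (additive_morph_sum (coefD t)).
by apply: eq_bigr => p _; rewrite coef_tensE.
Qed.

Lemma twisted_tens_rep f s : twisted_tens alpha f << s >> =
  twisted_tens alpha (linf_act alpha f (pos s)) << orbit_rep s >>.
Proof.
by rewrite /twisted_tens tensG chain_pushU push_orbit_rep.
Qed.

(** Collecting the terms orbit by orbit brings every chain into reduced form. *)
Lemma sum_coef r (T : seq (sing R (cover U) n)) :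
  let c := \sum_(p <- r) twisted_tens alpha p.1 << p.2 >> in
  uniq T -> {subset [seq orbit_rep p.2 | p <- r] <= T} ->
  c = \sum_(t <- T) twisted_tens alpha (coef t c) << t >>.
Proof.
move=> c uT rT.
under eq_bigr do rewrite /c coef_sum [twisted_tens _ _ _]tens_suml.
rewrite exchange_big /=; apply: eq_big_seq => p pr.
rewrite twisted_tens_rep -[LHS](@big_uniq_if _ _ _ _
  (fun t => twisted_tens alpha (linf_act alpha p.1 (pos p.2)) << t >>)
  uT (rT _ (rep_in pr))).
by apply: eq_bigr => t _; case: ifP => // _; rewrite tens0l.
Qed.

(** The coefficient functionals are intrinsic to the chain and isometric on
    each term, so any two reduced forms have the same norm. *)
Lemma reduced_form_norm c r (T : seq (sing R (cover U) n)) :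
  reduced_form c r -> uniq T -> {subset [seq orbit_rep p.2 | p <- r] <= T} ->
  \sum_(p <- r) linf_norm p.1 = \sum_(t <- T) linf_norm (coef t c).
Proof.
case=> -> pw uT rT.
have ur : uniq [seq orbit_rep p.2 | p <- r].
  rewrite uniq_pairwise pairwise_map; apply: sub_pairwise pw => p q /asboolP so /=.
  by apply/eqP => pq; apply/so/same_orbitP.
rewrite (big_uniq_supp ur uT rT) => [|t tr]; last first.
  rewrite coef_sum big_seq big1 ?linf_norm0 // => p pr.
  by case: eqP => // pt; move: tr; rewrite -pt (rep_in pr).
rewrite big_map; apply: eq_big_seq => p pr.
rewrite coef_sum (bigD1_seq p) ?(map_uniq ur) //= eqxx big_seq_cond big1.
  by rewrite addr0 linf_norm_act.
move=> q /andP[qr qp]; case: eqP => // qpE; move: qp.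
suff -> : q = p by rewrite eqxx.
have /(uniqP (orbit_rep p.2)) inj := ur.
have qpi : index q r = index p r.
  apply: inj; rewrite ?inE ?size_map ?index_mem //.
  by rewrite !(nth_map p) ?index_mem // !nth_index // qpE.
by rewrite -(nth_index p qr) qpi nth_index.
Qed.

Lemma twisted_chain_sum c :
  exists r, c = \sum_(p <- r) twisted_tens alpha p.1 << p.2 >>.
Proof.
elim/tensor_ind: c => [|x y [r ->] [r' ->]|f z].
- by exists [::]; rewrite big_nil.
- by exists (r ++ r'); rewrite big_cat.
exists [seq (f *~ coeff s z, s) | s <- dom z].
rewrite big_map /= -[in LHS](freeg_sumE z) tens_sumr; apply: eq_bigr => s _.
by rewrite -[coeff s z]intz -freegU_mulz tensMz intz.
Qed.

Lemma twisted_normE r (T : seq (sing R (cover U) n)) :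
  let c := \sum_(p <- r) twisted_tens alpha p.1 << p.2 >> in
  uniq T -> {subset [seq orbit_rep p.2 | p <- r] <= T} ->
  twisted_norm c = \sum_(t <- T) linf_norm (coef t c).
Proof.
move=> c uT rT; rewrite /twisted_norm; case: xgetP => [v _ [r' red ->]|]; last first.
  pose T' := undup [seq orbit_rep p.2 | p <- r].
  move=> /(_ (\sum_(p <- [seq (coef t c, t) | t <- T']) linf_norm p.1))[].
  exists [seq (coef t c, t) | t <- T'] => //; split.
    rewrite big_map; apply: sum_coef; rewrite ?undup_uniq // => t.
    by rewrite mem_undup.
  rewrite pairwise_map.
  have : all (fun t => orbit_rep t == t) T'.
    apply/allP => t; rewrite mem_undup => /mapP[p _ ->]; exact/eqP/orbit_repK.
  have := undup_uniq [seq orbit_rep p.2 | p <- r]; rewrite -/T' uniq_pairwise.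
  move=> pw aT; apply: (sub_in_pairwise (P := fun t => orbit_rep t == t)) aT pw => //.
  move=> s t sT tT /= st; have {sT} sr := eqP sT; have {tT} tr := eqP tT.
  have nst : ~ same_orbit s t by move=> /same_orbitP; rewrite sr tr; exact/eqP.
  exact: (asboolT nst).
pose T' := undup (T ++ [seq orbit_rep p.2 | p <- r']).
have sub t : t \in T -> t \in T' by rewrite mem_undup mem_cat => ->.
rewrite (reduced_form_norm red (undup_uniq _ : uniq T')); last first.
  by move=> t tr; rewrite mem_undup mem_cat tr orbT.
apply: big_uniq_supp; rewrite ?undup_uniq // => t tT.
rewrite coef_sum big_seq big1 ?linf_norm0 // => p pr.
by case: eqP => // pt; move: tT; rewrite -pt rT // rep_in.
Qed.

(** An unreduced presentation bounds the norm from above: collecting terms in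
    the same orbit only uses the triangle inequality and invariance. *)
Lemma ler_twisted_norm_sum r :
  twisted_norm (\sum_(p <- r) twisted_tens alpha p.1 << p.2 >>) <=
  \sum_(p <- r) linf_norm p.1.
Proof.
pose T := undup [seq orbit_rep p.2 | p <- r].
rewrite (@twisted_normE r T) ?undup_uniq // => [|t]; last by rewrite mem_undup.
under eq_bigr do rewrite coef_sum.
apply: le_trans (ler_sum _ (fun t _ => ler_linf_norm_sum _ _ _)) _.
rewrite exchange_big /= le_eqVlt; apply/orP; left; apply/eqP.
apply: eq_big_seq => p pr.
under eq_bigr do rewrite (fun_if (@linf_norm _ _ _ _)) linf_norm0 linf_norm_act.
rewrite (@big_uniq_if _ _ _ _ (fun=> linf_norm p.1)) ?undup_uniq //.
by rewrite mem_undup rep_in.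
Qed.

Lemma twisted_norm_ge0 c : 0 <= twisted_norm c.
Proof.
rewrite /twisted_norm; case: xgetP => // v _ [r _ ->].
by apply: sumr_ge0 => p _; exact: linf_norm_ge0.
Qed.

Lemma twisted_norm_eq0 c : twisted_norm c = 0 -> c = 0.
Proof.
have [r cr] := twisted_chain_sum c; pose T := undup [seq orbit_rep p.2 | p <- r].
have rT : {subset [seq orbit_rep p.2 | p <- r] <= T} by move=> t; rewrite mem_undup.
rewrite cr (twisted_normE (undup_uniq _ : uniq T) rT) => /eqP.
rewrite psumr_eq0 => [/allP T0|t _]; last exact: linf_norm_ge0.
rewrite (sum_coef (undup_uniq _ : uniq T) rT) big_seq big1 // => t tT.
by rewrite (linf_norm_eq0 (eqP (T0 t tT))) [LHS]tens0l.
Qed.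

Lemma twisted_norm0 : twisted_norm (0 : twisted_chain U alpha n) = 0.
Proof.
apply/eqP; rewrite eq_le twisted_norm_ge0 andbT.
by have := ler_twisted_norm_sum [::]; rewrite !big_nil.
Qed.

End TwistedNorm.

(** * Filling along an approximate coboundary *)

Section Restriction.
Context (R : realType) (disp : measure_display) (X : measurableType disp)
  (mu : probability X R).
Implicit Types (f : linf_fun mu) (A : set X).

Lemma linf_restrict_subproof f A : measurable A ->
  (fun x => if x \in A then f x else 0) \in @ess_bounded_int R disp X mu.
Proof.
move=> mA; have /asboolP[mf [b fb]] := linf_valP f; apply/asboolP; split.
  move=> B.
  have -> : (fun x => if x \in A then f x else 0) @^-1` B =
      (A `&` f @^-1` B) `|` (~` A `&` [set _ | B 0]).
    apply/seteqP; split=> [x /=|x /= [[xA fB]|[xA B0]]]; last first.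
    - by rewrite memNset.
    - by rewrite mem_set.
    by case: ifPn => [/set_mem xA|/negP xA Bx]; [left|right; split=> // /mem_set].
  apply: measurableU; apply: measurableI => //; first exact: measurableC.
  rewrite -[X in measurable X]/(cst 0 @^-1` B) preimage_cst.
  by case: ifP => _; [exact: measurableT|exact: measurable0].
exists b; apply: filterS fb => x; case: ifP => // _; rewrite normr0.
exact: le_trans.
Qed.

Definition linf_restrict f A (mA : measurable A) : linf_fun mu :=
  LinfFun (linf_restrict_subproof f mA).

Lemma linf_restrictE f A (mA : measurable A) x :
  linf_restrict f mA x = if x \in A then f x else 0.
Proof. by []. Qed.

Lemma linf_norm_restrict f A (mA : measurable A) (b : R) :
  0 <= b -> (\forall x \ae mu, `|f x|%:~R <= b) ->
  linf_norm (linf_class (linf_restrict f mA)) <= b * fine (mu A).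
Proof.
move=> b0 fb; rewrite -lee_fin linf_norm_class EFinM fineK; last first.
  by apply: fin_num_measure.
have -> : (mu A = \int[mu]_x (\1_A x)%:E)%E by rewrite integral_indic // setIT.
rewrite -ge0_integralZl_EFin //; last first.
  exact/measurable_EFinP/measurable_indic.

apply: ae_ge0_le_integral => //. 

- exact: measurable_linf_abs.
- by move=> x _; rewrite -EFinM lee_fin mulr_ge0.
- under eq_fun do rewrite -EFinM.
  apply/measurable_EFinP/measurable_funM; first exact: measurable_cst.
  exact: measurable_indic.
apply: filterS fb => x fx _; rewrite linf_restrictE indicE -EFinM lee_fin.
by case: ifP => _; rewrite ?mulr1 // mulr0 normr0.
Qed.

(** Norm estimates are reduced to inequalities between integers at a point. *)
Lemma ler_linf_norm_pointwise (s t : seq (linf_fun mu)) :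
  (forall x, \sum_(f <- s) `|f x| <= \sum_(f <- t) `|f x|) ->
  \sum_(f <- s) linf_norm (linf_class f) <= \sum_(f <- t) linf_norm (linf_class f).
Proof.
have sumE (u : seq (linf_fun mu)) : (\sum_(f <- u) linf_norm (linf_class f))%:E =
    (\int[mu]_x (\sum_(f <- u) `|f x|)%:~R%:E)%E.
  rewrite -sumEFin; under eq_bigr do rewrite linf_norm_class.
  rewrite -ge0_integral_sum //; last by move=> f; exact: measurable_linf_abs.
  by apply: eq_integral => x _; rewrite raddf_sum -sumEFin.
move=> st; rewrite -lee_fin !sumE.
apply: ge0_le_integral => //.
- by move=> x _; rewrite lee_fin ler0z sumr_ge0.
- under eq_fun do rewrite raddf_sum -sumEFin /=.
  by apply: emeasurable_sum => f; exact: measurable_linf_abs.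
- under eq_fun do rewrite raddf_sum -sumEFin /=.
  by apply: emeasurable_sum => f; exact: measurable_linf_abs.
by move=> x _; rewrite lee_fin ler_int.
Qed.

End Restriction.

Section Pointwise.
Context (R : numDomainType) (G : eqType) (I : Type).

Lemma sum_uniq_if_le (H : seq G) (w : G) (a : R) : uniq H -> 0 <= a ->
  \sum_(h <- H) (if w == h then a else 0) <= a.
Proof.
move=> uH a0; case: (boolP (w \in H)) => wH; first by rewrite big_uniq_if.
by rewrite big_seq big1 // => h hH; case: eqP wH => // ->; rewrite hH.
Qed.

(** If all the labels v i agree with w, the left side is the norm of the single
    sum over i. A label that disagrees moves one term to another fibre, which
    costs at most its norm once in each of the two fibres involved. *)
Lemma sum_fiber_le (H : seq G) (r : seq I) (P : pred I) (w : G) (v : I -> G)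
    (a : I -> R) : uniq H ->
  \sum_(h <- H) `|\sum_(i <- r | P i) (if v i == h then a i else 0)| <=
  `|\sum_(i <- r | P i) a i| +
  \sum_(i <- r | P i) (if v i == w then 0 else `|a i| *+ 2).
Proof.
move=> uH.
have step h : `|\sum_(i <- r | P i) (if v i == h then a i else 0)| <=
    (if w == h then `|\sum_(i <- r | P i) a i| else 0) +
    \sum_(i <- r | P i) (if v i == w then 0 else
      (if v i == h then `|a i| else 0) + (if w == h then `|a i| else 0)).
  have -> : \sum_(i <- r | P i) (if v i == h then a i else 0) =
      (if w == h then \sum_(i <- r | P i) a i else 0) +
      \sum_(i <- r | P i) ((if v i == h then a i else 0) -
        (if w == h then a i else 0)).
    rewrite big_split /= sumrN; case: ifP => _; first by rewrite addrCA subrr addr0.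
    by rewrite [X in _ - X]big1 // subr0 add0r.
  apply: le_trans (ler_normD _ _) _; apply: lerD.
    by case: ifP => _; rewrite ?normr0.
  apply: le_trans (ler_norm_sum _ _ _) _; apply: ler_sum => i _.
  case: (eqVneq (v i) w) => [->|_]; first by rewrite subrr normr0.
  by apply: le_trans (ler_normB _ _) _; do 2 case: ifP => _; rewrite ?normr0.
apply: le_trans (ler_sum _ (fun h _ => step h)) _.
rewrite big_split /=; apply: lerD; first exact: sum_uniq_if_le.
rewrite exchange_big /=; apply: ler_sum => i _.
case: ifP => _; first by rewrite big1.
by rewrite big_split mulr2n /=; apply: lerD; exact: sum_uniq_if_le.
Qed.

End Pointwise.

Section LinearExtension.
Context (R : realType) (E : topologicalType) (n : nat)
  (cone : sing R E n -> sing R E n.+1).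

Definition cone_chain (z : sing_chain R E n) : sing_chain R E n.+1 :=
  fglift (fun s => << cone s >> : sing_chain R E n.+1) z.

Lemma cone_chainB : {morph cone_chain : x y / x - y}.
Proof. exact: lift_is_additive. Qed.

Lemma cone_chainD : {morph cone_chain : x y / x + y}.
Proof. exact/subr_morph_addr/cone_chainB. Qed.

Lemma cone_chainU (k : int) s : cone_chain << k *g s >> = << k *g cone s >>.
Proof.
rewrite /cone_chain liftU; apply/eqP/freeg_eqP => t.
by rewrite coeffZ !coeffU mul1r.
Qed.

End LinearExtension.

Section Filling.
Context (R : realType) (G : zmodType) (M : topologicalType)
  (U : universal_covering R G M) (disp : measure_display)
  (X : measurableType disp) (mu : probability X R) (alpha : pmp_action G mu).
Context (n : nat) (pos : sing R (cover U) n -> G)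
  (pos' : sing R (cover U) n.+1 -> G).
Hypothesis pos_push : forall s g, pos (sing_push (deck U g) s) = g + pos s.
Hypothesis pos'_push : forall s g, pos' (sing_push (deck U g) s) = g + pos' s.
Context (cone : sing R (cover U) n -> sing R (cover U) n.+1).
Hypothesis bd_cone : forall z : sing_chain R (cover U) n.+1,
  sing_bd (cone_chain cone (sing_bd z)) = sing_bd z.

Context (gamma : X -> G) (L : seq G).
Hypothesis uL : uniq L.
Hypothesis gammaL : forall x, gamma x \in L.
Hypothesis mgamma : forall g, measurable (gamma @^-1` [set g]).

(** The points where gamma fails to make k a coboundary. Reading gamma x as the
    displacement from x to the centre of its tile, these are the x such that x
    and k . x lie in different tiles. *)
Definition defect (k : G) : set X := [set x | gamma (alpha k x) + k <> gamma x].

Lemma measurable_defect k : measurable (defect k).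
Proof.
have -> : defect k = ~` \big[setU/set0]_(g <- L)
    (gamma @^-1` [set g] `&` alpha k @^-1` (gamma @^-1` [set g - k])).
  apply/seteqP; split=> x.
    move=> bx; rewrite -bigcup_seq => -[g _ [/= <- gk]].
    by apply: bx; rewrite gk subrK.
  rewrite -bigcup_seq => bx xx; apply: bx; exists (gamma x); first exact: gammaL.
  by split => //=; rewrite -xx addrK.
apply/measurableC/bigsetU_measurable => g _; apply: measurableI => //.
by rewrite -[X in measurable X]setTI; exact: act_measurable.
Qed.

Definition level (f : linf_fun mu) g := linf_restrict f (mgamma g).

Lemma levelE f g x : level f g x = if gamma x == g then f x else 0.
Proof.
rewrite linf_restrictE; case: (eqVneq (gamma x) g) => xg.
  by rewrite mem_set.
by rewrite memNset // => /eqP; rewrite (negPf xg).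
Qed.

Lemma sum_level f : \sum_(g <- L) linf_class (level f g) = linf_class f.
Proof.
rewrite -linf_class_sum; congr linf_class; apply: val_inj; apply/funext => x /=.
rewrite linf_fun_sum; under eq_bigr do rewrite levelE.
exact: big_uniq_if.
Qed.

Lemma level_notin f g : g \notin L -> linf_class (level f g) = 0.
Proof.
move=> gL; rewrite -linf_class0; apply/linf_classP/nearW => x.
by rewrite levelE; case: eqP gL => // <-; rewrite gammaL.
Qed.

(** Each term f (x) s is cut along the fibres of gamma; the piece with gamma = g
    is moved by g, so that it becomes a coefficient on the centres, and only
    then coned. Coning is not equivariant, so the choice of the translate
    matters: all pieces belonging to one tile are coned from the same apex. *)
Definition fill (r : seq (linf_fun mu * sing R (cover U) n)) :
    twisted_chain U alpha n.+1 :=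
  \sum_(p <- r) \sum_(g <- L) twisted_tens alpha
    (linf_act alpha (linf_class (level p.1 g)) (- g))
    << cone (sing_push (deck U g) p.2) >>.

(** The presentation of the boundary by the faces, without cancellation. *)
Definition face_seq (b : seq (linf_fun mu * sing R (cover U) n.+1)) :
    seq (linf_fun mu * sing R (cover U) n) :=
  [seq (p.1 *~ ((-1) ^+ (i : 'I_n.+2)), sing_face i p.2) | p <- b, i <- index_enum 'I_n.+2].

Lemma linf_class_Mz (f : linf_fun mu) (k : int) : linf_class (f *~ k) = linf_class f *~ k.
Proof. exact/additive_morphMz/linf_classD. Qed.

Lemma tens_freegU m (u : Linf mu) k (s : sing R (cover U) m) :
  twisted_tens alpha u << k *g s >> = twisted_tens alpha (u *~ k) << s >>.
Proof. by rewrite -[k in LHS]intz -freegU_mulz /twisted_tens tensMz. Qed.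

Lemma face_seq_bd (b : seq (linf_fun mu * sing R (cover U) n.+1)) :
  \sum_(p <- face_seq b) twisted_tens alpha (linf_class p.1) << p.2 >> =
  twisted_bd (\sum_(p <- b) twisted_tens alpha (linf_class p.1) << p.2 >>).
Proof.
rewrite big_allpairs_dep /= (additive_morph_sum (@twisted_bdD R G M U disp X mu alpha n)).
apply: eq_bigr => p _; rewrite twisted_bd_tens sing_bdU [RHS]tens_sumr.
by apply: eq_bigr => i _; rewrite [RHS]tens_freegU linf_class_Mz.
Qed.

Lemma level_Mz f g (k : int) : linf_class (level (f *~ k) g) =
  linf_class (level f g) *~ k.
Proof.
rewrite -linf_class_Mz; apply/linf_classP/nearW => x; rewrite levelE.
have vMz (h : linf_fun mu) : (h *~ k) x = h x *~ k.
  exact: (@additive_morphMz (linf_fun mu) int (fun h : linf_fun mu => h x)).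
by rewrite !vMz levelE; case: ifP => // _; rewrite mul0rz.
Qed.

(** After the cut, the cone operator acts on each translate of the boundary of a
    simplex separately, where it is inverted by the boundary operator; moving
    the pieces back and summing over g reassembles the boundary of b. *)
Lemma fill_bd (b : seq (linf_fun mu * sing R (cover U) n.+1)) :
  twisted_bd (fill (face_seq b)) =
  twisted_bd (\sum_(p <- b) twisted_tens alpha (linf_class p.1) << p.2 >>).
Proof.
rewrite /fill big_allpairs_dep /=.
rewrite !(additive_morph_sum (@twisted_bdD R G M U disp X mu alpha n)).
apply: eq_bigr => -[f s] _ /=; rewrite exchange_big /=.
rewrite (additive_morph_sum (@twisted_bdD R G M U disp X mu alpha n)).
rewrite twisted_bd_tens -[in RHS]sum_level [RHS]tens_suml; apply: eq_bigr => g _.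
set u := linf_act alpha (linf_class (level f g)) (- g).
transitivity (twisted_bd (twisted_tens alpha u
    (cone_chain cone (sing_bd (chain_push (deck U g) << s >>))))).
  congr twisted_bd; rewrite sing_bd_push sing_bdU raddf_sum.
  rewrite (additive_morph_sum (cone_chainD cone)) [RHS]tens_sumr; apply: eq_bigr => i _.
  rewrite /= chain_pushU cone_chainU [RHS]tens_freegU; congr twisted_tens.
  rewrite level_Mz.
  exact: (@additive_morphMz _ _ (fun u => linf_act alpha u (- g))
    (fun u v => linf_actDl alpha u v (- g))).
rewrite twisted_bd_tens bd_cone sing_bd_push /twisted_tens -tensG linf_actA.
by rewrite addNr linf_act0.
Qed.

Lemma linf_act_sum (I : Type) (r : seq I) (P : pred I) (F : I -> Linf mu) g :
  linf_act alpha (\sum_(i <- r | P i) F i) g =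
  \sum_(i <- r | P i) linf_act alpha (F i) g.
Proof.
exact: (@additive_morph_sum _ _ (fun u => linf_act alpha u g)
    (fun u v => linf_actDl alpha u v g)).
Qed.

(** The term p of r, a face in the orbit of t at position k = pos p.2, meets the
    simplex h . t precisely on the points with gamma (k . x) + k = h. Where
    gamma is a coboundary for all the k involved, h = gamma x does not depend on
    p, so the same cancellation takes place as in the coefficient of the chain
    at t, and the cost is the norm of the chain. The other points contribute the
    error term. *)
Lemma fill_norm (r : seq (linf_fun mu * sing R (cover U) n))
    (beta : linf_fun mu -> R) :
  (forall f, 0 <= beta f /\ \forall x \ae mu, `|f x|%:~R <= beta f) ->
  twisted_norm (fill r) <=
  twisted_norm (\sum_(p <- r) twisted_tens alpha (linf_class p.1) << p.2 >>) +
  \sum_(p <- r) beta p.1 *+ 2 * fine (mu (defect (pos p.2))).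
Proof.
move=> fbeta; pose r' := [seq (linf_class p.1, p.2) | p <- r].
pose rep := orbit_rep pos.
pose T := undup [seq rep p.2 | p <- r'].
have uT : uniq T := undup_uniq _.
have rT : {subset [seq rep p.2 | p <- r'] <= T} by move=> t; rewrite mem_undup.
have pT p : p \in r -> rep p.2 \in T.
  by move=> pr; apply/rT/mapP; exists (linf_class p.1, p.2) => //; apply/mapP; exists p.
pose H := undup [seq g + pos p.2 | p <- r, g <- L].
have uH : uniq H := undup_uniq _.
(* The coefficient of the filling at the cone over h . t. *)
pose D t h := \sum_(p <- r | rep p.2 == t)
  linf_act alpha (linf_class (level p.1 (h - pos p.2))) (pos p.2 - h).
have fillE : fill r = \sum_(q <- [seq (D t h, cone (sing_push (deck U h) t)) |
    t <- T, h <- H]) twisted_tens alpha q.1 << q.2 >>.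
  rewrite big_allpairs_dep /=.
  under [RHS]eq_bigr do under eq_bigr do rewrite [twisted_tens _ _ _]tens_suml
    big_mkcond /=.
  under [RHS]eq_bigr do rewrite exchange_big /=.
  rewrite [RHS]exchange_big /=; apply: eq_big_seq => p pr.
  pose F h := twisted_tens alpha
    (linf_act alpha (linf_class (level p.1 (h - pos p.2))) (pos p.2 - h))
    << cone (sing_push (deck U h) (rep p.2)) >>.
  transitivity (\sum_(h <- H) F h); last first.
    rewrite -(@big_uniq_if _ _ _ _ (fun=> \sum_(h <- H) F h) uT (pT _ pr)).
    apply: eq_bigr => t _; case: eqP => [<- //|_]; first by rewrite big1.
  pose Lp := [seq g + pos p.2 | g <- L].
  have uLp : uniq Lp by rewrite map_inj_uniq //; exact: addIr.
  rewrite (big_uniq_supp uLp uH); last first.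
  - move=> h hL; rewrite /F level_notin; last first.
      apply: contra hL => hL; apply/mapP; exists (h - pos p.2) => //.
      by rewrite subrK.
    rewrite (@additive_morph0 _ _ (fun u => linf_act alpha u (pos p.2 - h))
      (fun u v => linf_actDl alpha u v _)).
    exact: tens0l.
  - move=> h /mapP[g gL ->]; rewrite mem_undup; apply/allpairsP.
    by exists (p, g).
  rewrite big_map; apply: eq_bigr => g _; rewrite /F addrK opprD addrCA subrr addr0.
  by rewrite sing_pushD push_orbit_rep.
rewrite fillE; apply: le_trans (ler_twisted_norm_sum alpha pos'_push _) _.
rewrite big_allpairs_dep /=.
have -> : \sum_(p <- r) twisted_tens alpha (linf_class p.1) << p.2 >> =
   \sum_(p <- r') twisted_tens alpha p.1 << p.2 >> by rewrite big_map.
rewrite (twisted_normE alpha pos_push uT rT).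
have -> : \sum_(p <- r) beta p.1 *+ 2 * fine (mu (defect (pos p.2))) =
    \sum_(t <- T) \sum_(p <- r | rep p.2 == t)
      beta p.1 *+ 2 * fine (mu (defect (pos p.2))).
  under [RHS]eq_bigr do rewrite big_mkcond /=.
  rewrite [RHS]exchange_big /=; apply: eq_big_seq => p pr.
  by rewrite (@big_uniq_if _ _ _ _ (fun=> _) uT (pT _ pr)).
rewrite -big_split /=; apply: ler_sum => t _.
rewrite coef_sum // big_map /= -big_mkcond /=.
pose B := \sum_(p <- r | rep p.2 == t) linf_shift alpha p.1 (pos p.2).
pose E (p : linf_fun mu * sing R (cover U) n) :=
  linf_restrict (linf_shift alpha p.1 (pos p.2) *+ 2) (measurable_defect (pos p.2)).
pose Psi h := \sum_(p <- r | rep p.2 == t)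
  linf_shift alpha (level p.1 (h - pos p.2)) (pos p.2).
have pw x : \sum_(f <- [seq Psi h | h <- H]) `|f x| <=
    \sum_(f <- B :: [seq E p | p <- r & rep p.2 == t]) `|f x|.
  rewrite big_cons !big_map big_filter /B linf_fun_sum.
  under eq_bigr do rewrite linf_fun_sum.
  (* The common label w is gamma x. *)
  have := @sum_fiber_le int G _ H r (fun p => rep p.2 == t) (gamma x)
    (fun p => gamma (alpha (pos p.2) x) + pos p.2)
    (fun p => p.1 (alpha (pos p.2) x)) uH.
  congr (_ <= _ + _).
    apply: eq_bigr => h _; congr (`|_|); apply: eq_bigr => p _.
    by rewrite linf_shiftE levelE (can2_eq (addrK _) (subrK _)).
  apply: eq_bigr => p _; rewrite /E linf_restrictE; case: eqP => [e|e].
    by rewrite memNset ?normr0 // => /(_ e).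
  by rewrite mem_set // linf_funMn normrMn.
have {pw} := ler_linf_norm_pointwise pw; rewrite big_cons !big_map big_filter /=.
rewrite (eq_bigr (fun h => linf_norm (D t h))) => [le1|h _]; last first.
  rewrite -(linf_norm_act alpha (D t h) h) linf_act_sum linf_class_sum.
  congr linf_norm; apply: eq_bigr => p _.
  by rewrite linf_actA subrK linf_act_class.
apply: le_trans le1 _; apply: lerD.
  rewrite /B linf_class_sum le_eqVlt; apply/orP; left; apply/eqP; congr linf_norm.
  by apply: eq_bigr => p _; rewrite linf_act_class.
apply: ler_sum => p _; have [b0 fb] := fbeta p.1.
apply: linf_norm_restrict; first by rewrite mulrn_wge0.
have := ae_act alpha (pos p.2) fb; apply: filterS => x fx.
by rewrite linf_funMn normrMn raddfMn lerMn2r.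
Qed.

End Filling.

(** * The boundary of a boundary *)

Section FaceMaps.
Context (R : realType).

Lemma face_ptE n (i : 'I_n.+2) (t : 'rV[R]_n.+1) (j : 'I_n.+2) :
  face_pt i t 0 j = if j == i then 0 else t 0 (inord (unbump i j)).
Proof.
rewrite mxE; case: unliftP => [k ->|->] /=; last by rewrite eqxx.
by rewrite eq_sym (negPf (neq_lift i k)) bumpK inord_val.
Qed.

Lemma face_mapE n (i : 'I_n.+2) (t : @std_simplex R n) (j : 'I_n.+2) :
  \val (face_map i t) 0 j = if j == i then 0 else \val t 0 (inord (unbump i j)).
Proof. exact: face_ptE. Qed.

Lemma face_map_face_map n (i : 'I_n.+3) (l : 'I_n.+2) (t : @std_simplex R n) :
  (l < i)%N ->
  face_map i (face_map l t) = face_map (inord l) (face_map (inord i.-1) t).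
Proof.
move=> li; apply: val_inj; apply/rowP => j.
have [[i2 l1] j2] := (ltn_ord i, ltn_ord l, ltn_ord j).
have lE : (inord l : 'I_n.+3) = l :> nat by rewrite inordK; lia.
have iE : (inord i.-1 : 'I_n.+2) = i.-1 :> nat by rewrite inordK; lia.
rewrite !face_mapE -!val_eqE /= lE iE.
have [->|ji] := eqVneq (j : nat) (i : nat).
  rewrite (gtn_eqF li) inordK; last by rewrite /unbump; lia.
  by rewrite (_ : unbump l i = i.-1) ?eqxx // /unbump li subn1.
rewrite !inordK; try by rewrite /unbump; lia.
rewrite (_ : (unbump i j == l) = ((j : nat) == l)); last first.
  by rewrite /unbump; apply/eqP/eqP; lia.
case: eqP => // jl; rewrite (_ : (unbump l j == i.-1) = false); last first.
  by apply/eqP; rewrite /unbump; lia.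
by congr (\val t 0 (inord _)); rewrite /unbump; lia.
Qed.

Lemma sing_bdUk (E : topologicalType) n (k : int) (s : sing R E n.+1) :
  sing_bd << k *g s >> = \sum_(i < n.+2) << k * (-1) ^+ i *g sing_face i s >>.
Proof.
rewrite -[k in LHS]intz -freegU_mulz raddfMz /= sing_bdU.
rewrite mulrz_suml; apply: eq_bigr => i _; apply/eqP/freeg_eqP => t.
by rewrite raddfMz /= !coeffU -mulrzl intz mulrA.
Qed.

Lemma freeg_eq_opp (K : choiceType) (x : {freeg K / int}) : x = - x -> x = 0.
Proof.
move=> xx; apply/eqP/freeg_eqP => k; have := congr1 (coeff k) xx.
by rewrite coeffN coeff0; lia.
Qed.

(** The fixed-point free involution on pairs of face indices under which the
    terms of the iterated boundary cancel: the simplicial identity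
    d_l d_i = d_(i-1) d_l for l < i, read in both directions. *)
Definition swap_faces n (p : 'I_n.+3 * 'I_n.+2) : 'I_n.+3 * 'I_n.+2 :=
  if (p.2 < p.1)%N then (inord p.2, inord p.1.-1) else (inord p.2.+1, inord p.1).

Lemma swap_facesK n : involutive (@swap_faces n).
Proof.
move=> [i l]; rewrite /swap_faces /=; have [i2 l1] := (ltn_ord i, ltn_ord l).
case li : (l < i)%N => /=.
  rewrite !inordK; try lia.
  rewrite ifF; last by lia.
  by rewrite prednK ?inord_val //; lia.
rewrite !inordK; try lia.
by rewrite ifT; [rewrite /= !inord_val|lia].
Qed.

(** Reindexing by swap_faces changes the sign of the sum, and chain groups have
    no 2-torsion. *)
Lemma sing_bd_bd (E : topologicalType) n (z : sing_chain R E n.+2) :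
  sing_bd (sing_bd z) = 0.
Proof.
apply: (@freeg_additive_eq _ _ (fun z => sing_bd (sing_bd z)) (fun=> 0)) => [x y|x y|s].
- by rewrite !raddfB.
- by rewrite subr0.
apply: freeg_eq_opp.
pose F (p : 'I_n.+3 * 'I_n.+2) : sing_chain R E n :=
  << (-1) ^+ p.1 * (-1) ^+ p.2 *g sing_face p.2 (sing_face p.1 s) >>.
have -> : sing_bd (sing_bd << s >>) = \sum_p F p.
  rewrite sing_bdU raddf_sum -(pair_bigA _ (fun i l => F (i, l))) /=.
  by apply: eq_bigr => i _; rewrite sing_bdUk.
rewrite [LHS](reindex_inj (inv_inj (@swap_facesK n))) -sumrN.
have swapF (i : 'I_n.+3) (l : 'I_n.+2) : (l < i)%N ->
    F (swap_faces (i, l)) = - F (i, l).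
  move=> li; have [i2 l1] := (ltn_ord i, ltn_ord l).
  rewrite /F /swap_faces /= li /= !inordK; try lia.
  apply/eqP/freeg_eqP => t; rewrite coeffN !coeffU.
  have -> : sing_face (inord i.-1) (sing_face (inord l) s) =
      sing_face l (sing_face i s).
    by apply/continuousEP => x /=; rewrite (face_map_face_map x li).
  rewrite -mulNr; congr (_ * _).
  case: (nat_of_ord i) li => // k _; rewrite /= exprS.
  by rewrite !mulN1r mulNr opprK mulrC.
apply: eq_bigr => -[i l] _; have [/swapF //|il] := boolP (l < i)%N.
have [i2 l1] := (ltn_ord i, ltn_ord l).
suff : F (swap_faces (swap_faces (i, l))) = - F (swap_faces (i, l)).
  by rewrite swap_facesK => ->; rewrite opprK.
have -> : swap_faces (i, l) = (inord l.+1, inord i).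
  by rewrite /swap_faces /= ifN.
by apply: swapF; rewrite !inordK; lia.
Qed.

End FaceMaps.

(** * Cones in Euclidean space *)

Section Cone.
Context (R : realType) (d : nat).
Local Notation E := 'rV[R]_d.
(* Not the lift of freeg. *)
Local Notation lift := fintype.lift.

Lemma compact_std_simplex n : compact (@std_simplex R n).
Proof.
have cl : closed (@std_simplex R n).
  have -> : @std_simplex R n = (\bigcap_(i : 'I_n.+1) [set t : 'rV[R]_n.+1 | 0 <= t 0 i])
      `&` [set t : 'rV[R]_n.+1 | \sum_i t 0 i = 1].
    by apply/seteqP; split=> t [t0 t1]; split=> // i; [move=> _|]; exact: t0.
  apply: closedI.
    apply: closed_bigI => i _.
    apply: (@closed_comp _ _ (fun t : 'rV[R]_n.+1 => t 0 i) [set x | 0 <= x]).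
      by move=> t _; exact: continuous_entry.
    exact: closed_ge.
  apply: (@closed_comp _ _ (fun t : 'rV[R]_n.+1 => \sum_i t 0 i) [set x | x = 1]).
    have cs (r : seq 'I_n.+1) : continuous (fun t : 'rV[R]_n.+1 => \sum_(i <- r) t 0 i).
      elim: r => [|i r IH] t.
        rewrite (_ : (fun _ => _) = cst 0); first exact: cst_continuous.
        by apply/funext => u; rewrite big_nil.
      rewrite (_ : (fun _ => _) = (fun t : 'rV[R]_n.+1 => t 0 i + \sum_(k <- r) t 0 k)).
        exact: (cvgD (@continuous_entry _ _ _ 0 i t) (IH t)).
      by apply/funext => u; rewrite big_cons.
    by move=> t _; exact: cs.
  exact: closed_eq.
apply: (subclosed_compact cl (@rV_compact R n.+1 (fun=> `[0, 1]%classic) _)).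
  by move=> i; exact: segment_compact.
move=> t [t0 t1] i /=; rewrite in_itv /= t0 /= -t1 (bigD1 i) //= lerDl.
by apply: sumr_ge0.
Qed.

(** Boundedness is what makes the cone continuous at its apex. *)
Lemma sing_bounded n (s : sing R E n) (j : 'I_d) :
  exists b : R, forall x, `|s x 0 j| <= b.
Proof.
have cf : continuous (fun x => s x 0 j).
  move=> x; apply: (@continuous_comp _ _ _ s (fun v : E => v 0 j)).
    exact: cts_fun.
  exact: continuous_entry.
have cF : {within @std_simplex R n, continuous (valL (fun x => s x 0 j))}.
  exact/subspace_valL_continuousP.
have /compact_bounded[M [_ sM]] := continuous_compact cF (@compact_std_simplex n).
exists (M + 1) => x; apply: sM; first by rewrite ltrDl.
exists (\val x); first exact: set_valP.
by have := congr1 (fun f => f x) (valLK point (fun x => s x 0 j)).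
Qed.


Definition simplex_vertex n : 'rV[R]_n.+1 := \row_j (j == ord0)%:R.

Lemma simplex_vertexP n : std_simplex (simplex_vertex n).
Proof.
split=> [j|]; first by rewrite mxE; case: (_ == _).
rewrite (bigD1 ord0) //= mxE eqxx big1 ?addr0 // => j.
by rewrite mxE => /negPf ->.
Qed.

Definition vertex0 n : @std_simplex R n := SigSub (mem_set (simplex_vertexP n)).

(** The point where the ray from the vertex 0 through t meets the opposite
    face. *)
Definition simplex_base n (t : 'rV[R]_n.+2) : 'rV[R]_n.+1 :=
  \row_j (t 0 (lift ord0 j) / (1 - t 0 ord0)).

(* At the vertex 0 itself the link is the junk value vertex0. *)
Definition simplex_link n (t : @std_simplex R n.+1) : @std_simplex R n :=
  insubd (vertex0 n) (simplex_base (\val t)).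

Lemma simplex_baseP n (t : @std_simplex R n.+1) :
  \val t 0 ord0 != 1 -> std_simplex (simplex_base (\val t)).
Proof.
have [t0 t1] := set_valP t => tn1.
rewrite big_ord_recl in t1.
have lt1 : 0 < 1 - \val t 0 ord0.
  rewrite subr_gt0 lt_neqAle tn1 -t1 lerDl.
  by apply: sumr_ge0.
split=> [j|]; first by rewrite mxE divr_ge0 // ltW.
under eq_bigr do rewrite mxE.
rewrite -mulr_suml (_ : \sum_(i < n.+1) _ = 1 - \val t 0 ord0); last first.
  by rewrite -[X in X - _]t1 addrAC subrr add0r.
by rewrite divff // gt_eqF.
Qed.

Lemma simplex_linkE n (t : @std_simplex R n.+1) :
  \val t 0 ord0 != 1 -> \val (simplex_link t) = simplex_base (\val t).
Proof. by move=> t1; rewrite /simplex_link insubdK //; exact/mem_set/simplex_baseP. Qed.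

Lemma continuous_val_entry n (j : 'I_n.+1) :
  continuous (fun t : @std_simplex R n => \val t 0 j).
Proof.
move=> t; apply: (@continuous_comp _ _ _ (fun y : @std_simplex R n => \val y)
          (fun M : 'rV[R]_n.+1 => M 0 j)).
  exact: initial_continuous.
exact: continuous_entry.
Qed.

Lemma simplex_link_continuous n (t : @std_simplex R n.+1) :
  \val t 0 ord0 != 1 -> {for t, continuous (@simplex_link n)}.
Proof.
move=> t1; have cb : {for t, continuous (fun y : @std_simplex R n.+1 => simplex_base (\val y))}.
  apply: continuous_mx => i j.
  have -> : (fun y : @std_simplex R n.+1 => simplex_base (\val y) i j) =
      (fun y : @std_simplex R n.+1 => \val y 0 (lift ord0 j) / (1 - \val y 0 ord0)).
    by apply/funext => y; rewrite mxE.
  apply: (cvgM (@continuous_val_entry _ _ t)).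
  apply: cvgV; first by rewrite subr_eq0 eq_sym.
  exact: (cvgB (cvg_cst _) (@continuous_val_entry _ _ t)).
have cv : {for t, continuous (fun y => \val (simplex_link y) : 'rV[R]_n.+1)}.
  rewrite /prop_for /continuous_at simplex_linkE //.
  apply: cvg_trans cb; apply: (@near_eq_cvg _ _ (nbhs t) (nbhs_filter t)
    (fun y : @std_simplex R n.+1 => simplex_base (\val y)) (fun y => \val (simplex_link y))).
  have : \forall y \near t, \val (y : @std_simplex R n.+1) 0 ord0 != 1.
    apply: (@continuous_val_entry _ ord0 t [set x : R | x != 1]).
    by apply: open_nbhs_nbhs; split=> //; exact: open_neq.
  by move=> h; apply: (filterS _ h) => y y1 /=; rewrite simplex_linkE.
move=> A [/= B [[W oW <-]] /= Wt sA].
have nW : nbhs (\val (simplex_link t) : 'rV[R]_n.+1) W by apply: open_nbhs_nbhs.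
apply: (@filterS _ (nbhs t) _ [set y | W (\val (simplex_link y))] [set y | A (simplex_link y)]).
  by move=> y Wy; exact: sA.
exact: (cv W nW).
Qed.

(** The apex is the origin, and corresponds to the vertex 0. *)
Definition cone_fun n (s : sing R E n) (t : @std_simplex R n.+1) : E :=
  (1 - \val t 0 ord0) *: s (simplex_link t).

Lemma cone_fun_continuous n (s : sing R E n) : continuous (cone_fun s).
Proof.
move=> t; apply: continuous_mx => i j; rewrite (ord1 i) {i}.
have -> : (fun y => cone_fun s y 0 j) =
    (fun y => (1 - \val y 0 ord0) * s (simplex_link y) 0 j).
  by apply/funext => y; rewrite mxE.
have ch : {for t, continuous (fun y : @std_simplex R n.+1 => 1 - \val y 0 ord0)}.
  exact: (cvgB (cvg_cst _) (@continuous_val_entry _ _ t)).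
have [t1|t1] := eqVneq (\val t 0 ord0) 1; last first.
  apply: (cvgM ch).
  apply: (@continuous_comp _ _ _ (@simplex_link n) (fun x => s x 0 j)).
    exact: simplex_link_continuous.
  apply: (@continuous_comp _ _ _ s (fun v : E => v 0 j)); first exact: cts_fun.
  exact: continuous_entry.
(* At the apex, the bounded factor is multiplied by one that tends to 0. *)
have [b sb] := sing_bounded s j.
rewrite /prop_for /continuous_at t1 subrr mul0r.
apply/norm_cvg0P; first exact: (nbhs_filter t).
have c0 : (fun y : @std_simplex R n.+1 => `|1 - \val y 0 ord0| * b) y @[y --> t] --> (0 : R).
  rewrite -[X in _ --> X](mul0r b) -(normr0 R) -(subrr 1) -[X in 1 - X]t1.
  exact: (cvgM (cvg_norm ch) (cvg_cst b)).
apply: (@squeeze_cvgr _ (nbhs t) (nbhs_filter t) R (cst 0) _ _ _ 0 (cvg_cst _) c0).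
by apply: nearW => y; rewrite normr_ge0 normrM ler_wpM2l.
Qed.

HB.instance Definition _ n (s : sing R E n) :=
  isContinuous.Build _ _ (cone_fun s) (@cone_fun_continuous n s).

Definition cone n (s : sing R E n) : sing R E n.+1 := cone_fun s.

Lemma cone_face0 n (s : sing R E n) : sing_face ord0 (cone s) = s.
Proof.
apply/continuousEP => x /=; rewrite /cone_fun.
have x0 : \val (face_map ord0 x) 0 ord0 = 0 by rewrite face_mapE eqxx.
rewrite x0 subr0 scale1r; congr (s _); apply: val_inj.
rewrite simplex_linkE ?x0 ?oner_neq0 1?eq_sym ?oner_eq0 //.
apply/rowP => j; rewrite mxE x0 subr0 divr1 face_mapE eq_sym (negPf (neq_lift ord0 j)).
by rewrite bumpK inord_val.
Qed.

Lemma cone_face_lift n (s : sing R E n.+1) (i : 'I_n.+2) :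
  sing_face (lift ord0 i) (cone s) = cone (sing_face i s).
Proof.
apply/continuousEP => x /=; rewrite /cone_fun.
have x0 : \val (face_map (lift ord0 i) x) 0 ord0 = \val x 0 ord0.
  rewrite face_mapE (negPf (neq_lift ord0 i)); congr (\val x 0 _).
  by apply: val_inj; rewrite /= inordK.
rewrite x0; have [->|x1] := eqVneq (\val x 0 ord0) 1; first by rewrite subrr !scale0r.
congr (_ *: s _); apply: val_inj; apply/rowP => j.
rewrite simplex_linkE ?x0 // face_mapE mxE x0 face_mapE simplex_linkE // mxE.
have [[i2 j2]] := (ltn_ord i, ltn_ord j).
have b0 k : bump 0 k = k.+1 by [].
rewrite -!val_eqE /= !b0 eqSS; case: eqP => ij; first by rewrite mul0r.
congr (\val x 0 _ / _); apply: val_inj; rewrite /= !inordK; rewrite /unbump /bump /=; lia.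
Qed.

(** In degree 0 the face opposite to the base degenerates to the apex. *)
Lemma cone_face_vertex (s : sing R E 0) (i : 'I_1) (x : @std_simplex R 0) :
  sing_face (lift ord0 i) (cone s) x = 0.
Proof.
have [_ x1] := set_valP x; rewrite big_ord1 in x1.
rewrite /= /cone_fun face_mapE (negPf (neq_lift ord0 i)).
rewrite (_ : \val x 0 _ = 1) ?subrr ?scale0r // -x1; congr (\val x 0 _).
by apply: val_inj; rewrite /= inordK.
Qed.

Lemma cone_chain1 n (s : sing R E n) : cone_chain (@cone n) << s >> = << cone s >>.
Proof. exact: cone_chainU. Qed.

(** In positive degree, boundary and cone satisfy bd (cone y) = y - cone (bd y),
    and bd (bd z) = 0. In degree 0 the correction is the augmentation of y times
    the apex, and the augmentation of a boundary vanishes. *)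
Lemma sing_bd_cone n (z : sing_chain R E n.+1) :
  sing_bd (cone_chain (@cone n) (sing_bd z)) = sing_bd z.
Proof.
case: n z => [|n] z; last first.
  have contr y : sing_bd (cone_chain (@cone n.+1) y) =
      y - cone_chain (@cone n) (sing_bd y).
    apply: (@freeg_additive_eq _ _ (fun y => sing_bd (cone_chain (@cone n.+1) y))
      (fun y => y - cone_chain (@cone n) (sing_bd y))) => [x t|x t|s].
    - by rewrite cone_chainB raddfB.
    - by rewrite raddfB cone_chainB [in LHS]opprD addrACA -opprD.
    rewrite cone_chain1 !sing_bdU big_ord_recl /= expr0 cone_face0; congr (_ + _).
    rewrite (additive_morph_sum (cone_chainD (@cone n))) -sumrN.
    apply: eq_bigr => i _; rewrite cone_chainU cone_face_lift.
    apply/eqP/freeg_eqP => t; rewrite coeffN !coeffU.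
    by rewrite /bump /= add1n exprS mulN1r mulNr.
  by rewrite contr sing_bd_bd (additive_morph0 (cone_chainD (@cone n))) subr0.
apply: (@freeg_additive_eq _ _ (fun z => sing_bd (cone_chain (@cone 0) (sing_bd z)))
  (fun z => sing_bd z)) => [x y|x y|s].
- by rewrite raddfB cone_chainB raddfB.
- by rewrite raddfB.
rewrite sing_bdU (additive_morph_sum (cone_chainD (@cone 0))) raddf_sum.
rewrite !big_ord_recl !big_ord0 /= !cone_chainU !sing_bdUk !big_ord_recl !big_ord0.
rewrite !cone_face0.
set a := sing_face ord0 s; set b := sing_face (lift ord0 ord0) s.
have -> : sing_face (lift ord0 ord0) (cone a) = sing_face (lift ord0 ord0) (cone b).
  by apply/continuousEP => x; rewrite !cone_face_vertex.
apply/eqP/freeg_eqP => t; rewrite !coeffD !coeff0 !coeffU /=.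
by rewrite /bump /= addn0 expr0 expr1; ring.
Qed.

(** The integer part of the initial vertex, an equivariant map from singular
    simplices to the lattice of translations. *)
Definition floor_pos n (s : sing R E n) : 'rV[int]_d :=
  \row_j Num.floor (s (vertex0 n) 0 j).

Lemma floor_pos_translate n (s : sing R E n) (g : 'rV[int]_d) :
  floor_pos (sing_push (translate g) s) = g + floor_pos s.
Proof.
apply/rowP => j; rewrite !mxE floorDrz ?intr_int //.
by rewrite intrKfloor addrC.
Qed.

End Cone.

(** * Polynomial growth *)

Section Growth.
Context (R : realType).

(** If every step multiplied by more than q, the total growth would exceed
    q ^+ T. *)
Lemma ratio_pigeonhole (a : nat -> R) (N q m : R) (T : nat) :
  0 <= q -> 0 <= m -> N <= q ^+ T -> (0 < T)%N -> m <= a 0 -> a T <= N * m ->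
  exists2 t, (t < T)%N & a t.+1 <= q * a t.
Proof.
move=> q0 m0 NT T0 ma aT; apply: contrapT => nt.
have step t : (t < T)%N -> q * a t < a t.+1.
  by move=> tT; rewrite ltNge; apply/negP => h; apply: nt; exists t.
have low t : (t <= T)%N -> q ^+ t * m <= a t.
  elim: t => [_|t IH tT]; first by rewrite expr0 mul1r.
  rewrite exprS -mulrA; apply: le_trans (ltW (step t tT)).
  by rewrite ler_wpM2l // IH // ltnW.
case: T T0 NT aT step low {nt} => // T _ NT aT step low.
have := step T (ltnSn T); rewrite ltNge => /negP; apply.
apply: (le_trans aT); apply: le_trans (_ : q ^+ T.+1 * m <= _).
  by rewrite ler_wpM2r.
by rewrite exprS -mulrA ler_wpM2l // low.
Qed.

Lemma bernoulli_le (x : R) n : 0 <= x -> 1 + x *+ n <= (1 + x) ^+ n.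
Proof.
move=> x0; elim: n => [|n IH]; first by rewrite mulr0n addr0 expr0.
rewrite exprS mulrS; apply: le_trans (_ : (1 + x) * (1 + x *+ n) <= _).
  have := mulr_ge0 x0 (mulrn_wge0 n x0); nra.
by rewrite ler_wpM2l // addr_ge0.
Qed.

(** With T a multiple m * (d + 1), Bernoulli's inequality bounds the right side
    below by (1 + m delta) ^+ (d + 1), of degree d + 1 in m, whereas the left
    side has degree d in m. *)
Lemma poly_lt_exp (delta : R) (s d : nat) : 0 < delta ->
  exists2 T, (0 < T)%N & ((2 * (T * s)).+1 ^ d)%:R <= (1 + delta) ^+ T :> R.
Proof.
move=> d0; pose A : R := 1 + (2 * (d.+1 * s))%:R / delta.
have A0 : 0 <= (2 * (d.+1 * s))%:R / delta by rewrite divr_ge0 // ltW.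
have A1 : 1 <= A by rewrite lerDl.
pose m := (Num.truncn (A ^+ d / delta)).+1.
(* A (1 + m delta) dominates the base of the left side, for every m. *)
have mA : A ^+ d <= m%:R * delta.
  rewrite -ler_pdivrMr //; apply/ltW/truncnS_gt.
have y0 : 0 <= delta *+ m by rewrite mulrn_wge0 // ltW.
exists (m * d.+1)%N => //.
rewrite exprM; apply: le_trans (_ : (1 + delta *+ m) ^+ d.+1 <= _); last first.
  apply: lerXn2r; rewrite ?nnegrE; first exact: addr_ge0.
    by apply/exprn_ge0/addr_ge0 => //; exact: ltW.
  by apply: bernoulli_le; exact: ltW.
rewrite natrX exprSr; apply: le_trans (_ : (A * (1 + delta *+ m)) ^+ d <= _).
  apply: lerXn2r; rewrite ?nnegrE //.
    by apply: mulr_ge0; exact: addr_ge0.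
  rewrite (_ : (2 * _).+1 = (1 + (2 * (d.+1 * s)) * m)%N); last by lia.
  rewrite natrD natrM; set c : R := (2 * (d.+1 * s))%:R in A0 *.
  have -> : c * m%:R = c / delta * (delta *+ m).
    by rewrite -[delta *+ m]mulr_natr [RHS]mulrA divfK // gt_eqF.
  rewrite /A -/c; move: A0 y0; set w := c / delta; set y := delta *+ m => w0 y0.
  have := mulr_ge0 w0 y0; nra.
rewrite exprMn mulrC; apply: ler_wpM2l; first exact/exprn_ge0/addr_ge0.
by apply: (le_trans mA); rewrite mulr_natl lerDr.
Qed.

End Growth.

Section LatticeBall.
Context (d : nat).

(** The lattice points of sup-norm at most r; the list is parametrised by a finite
    matrix type, which makes it easy to count. *)
Definition lattice_ball (r : nat) : seq 'rV[int]_d :=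
  [seq \row_j ((nat_of_ord ((M : 'rV['I_(2 * r).+1]_d) 0 j))%:Z - r%:Z) |
    M <- enum 'rV['I_(2 * r).+1]_d].

Lemma size_lattice_ball r : size (lattice_ball r) = ((2 * r).+1 ^ d)%N.
Proof. by rewrite size_map -cardE card_mx card_ord mul1n. Qed.

Lemma mem_lattice_ball r (g : 'rV[int]_d) :
  (g \in lattice_ball r) = [forall j, `|g 0 j| <= r%:Z].
Proof.
apply/mapP/forallP => [[M _ -> j]|gr].
  rewrite mxE; have := ltn_ord (M 0 j); move: (nat_of_ord _) => m mr.
   by rewrite ler_norml; lia.
exists (\row_j inord (absz (g 0 j + r%:Z))); first by rewrite mem_enum.
apply/rowP => j; rewrite !mxE; have := gr j => gj.
have e : Posz (absz (g 0 j + r%:Z)) = g 0 j + r%:Z.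
  by move: gj; rewrite ler_norml => gj; rewrite gez0_abs; lia.
move: gj; rewrite ler_norml => gj; rewrite inordK; last by rewrite ltnS -lez_nat e; lia.
by rewrite e addrK.
Qed.

Lemma lattice_ballP r (g : 'rV[int]_d) :
  reflect (forall j, `|g 0 j| <= r%:Z) (g \in lattice_ball r).
Proof. by rewrite mem_lattice_ball; apply: (iffP forallP). Qed.

Lemma lattice_ball0 r : 0 \in lattice_ball r.
Proof. by apply/lattice_ballP => j; rewrite mxE normr0. Qed.

Lemma lattice_ballN r g : (- g \in lattice_ball r) = (g \in lattice_ball r).
Proof. by rewrite !mem_lattice_ball; apply: eq_forallb => j; rewrite mxE normrN. Qed.

Lemma lattice_ballD r r' g g' : g \in lattice_ball r -> g' \in lattice_ball r' ->
  g + g' \in lattice_ball (r + r').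
Proof.
move=> /lattice_ballP gr /lattice_ballP gr'; apply/lattice_ballP => j.
by rewrite mxE PoszD; apply: le_trans (ler_normD _ _) (lerD (gr j) (gr' j)).
Qed.

Lemma lattice_ball_le r r' g : (r <= r')%N -> g \in lattice_ball r ->
  g \in lattice_ball r'.
Proof.
move=> rr' /lattice_ballP gr; apply/lattice_ballP => j.
by apply: le_trans (gr j) _; rewrite lez_nat.
Qed.

Lemma lattice_ball_sup (S : seq 'rV[int]_d) :
  exists s, {subset S <= lattice_ball s}.
Proof.
elim: S => [|g S [s Ss]]; first by exists 0%N.
exists (maxn s (\max_j absz (g 0%R j))) => h; rewrite inE => /orP[/eqP ->|hS].
  apply/lattice_ballP => j.
  rewrite -abszE lez_nat leq_max; apply/orP; right.
  exact: (@leq_bigmax _ (fun j : 'I_d => absz (g 0%R j)) j).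
by apply: lattice_ball_le (Ss _ hS); rewrite leq_maxl.
Qed.

End LatticeBall.

(** * Carving tiles out of a free action *)

Section Carving.
Context (R : realType) (d : nat) (disp : measure_display)
  (X : measurableType disp) (mu : probability X R)
  (alpha : pmp_action 'rV[int]_d mu).
Implicit Types (A B V W E : set X) (g k : 'rV[int]_d).

Definition pr A : R := fine (mu A).

Lemma prE A : measurable A -> (pr A)%:E = mu A.
Proof. by move=> mA; rewrite fineK // fin_num_measure. Qed.

Lemma pr_ge0 A : 0 <= pr A.
Proof. exact: fine_ge0. Qed.

Lemma pr_le A B : measurable A -> measurable B -> A `<=` B -> pr A <= pr B.
Proof. by move=> mA mB AB; rewrite -lee_fin !prE // le_measure // inE. Qed.

Lemma pr_setU_le A B : measurable A -> measurable B -> pr (A `|` B) <= pr A + pr B.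
Proof.
move=> mA mB; rewrite -lee_fin EFinD !prE //; last exact: measurableU.
exact: measureU2.
Qed.

Lemma pr_setU A B : measurable A -> measurable B -> A `&` B = set0 ->
  pr (A `|` B) = pr A + pr B.
Proof.
move=> mA mB AB; apply: EFin_inj; rewrite EFinD !prE //; last exact: measurableU.
exact: measureU.
Qed.

Lemma measurable_act A g : measurable A -> measurable (alpha g @^-1` A).
Proof. by move=> mA; rewrite -[X in measurable X]setTI; exact: act_measurable. Qed.

Lemma pr_act A g : measurable A -> pr (alpha g @^-1` A) = pr A.
Proof. by move=> mA; rewrite /pr act_pres. Qed.

Definition reach (r : nat) B : set X :=
  \big[setU/set0]_(g <- lattice_ball d r) (alpha g @^-1` B).

Lemma reachP r B x : reach r B x <-> exists2 g, g \in lattice_ball d r & B (alpha g x).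
Proof.
rewrite /reach -bigcup_seq; split=> [[g /= gr Bg]|[g gr Bg]]; by exists g.
Qed.

Lemma measurable_reach r B : measurable B -> measurable (reach r B).
Proof. by move=> mB; apply: bigsetU_measurable => g _; exact: measurable_act. Qed.

Lemma pr_reach r B : measurable B -> pr (reach r B) <= ((2 * r).+1 ^ d)%:R * pr B.
Proof.
move=> mB; rewrite -(size_lattice_ball d r) /reach.
elim: (lattice_ball d r) => [|g s IH].
  by rewrite big_nil mul0r /pr measure0.
rewrite big_cons /= mulrS mulrDl mul1r.
apply: le_trans (pr_setU_le _ _) _.
- exact: measurable_act.
- by apply: bigsetU_measurable => h _; exact: measurable_act.
by rewrite pr_act // lerD2l.
Qed.

Definition spread (F : seq 'rV[int]_d) B :=
  forall g x, g \in F -> g != 0 -> B x -> ~ B (alpha g x).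

(** V is partitioned into finite tiles, gamma x being the displacement from x to
    the centre of its tile. The set E collects outer boundaries of tiles, of
    width s: whenever x in V and k . x, with k in the ball of radius s, do not
    lie in the same tile, one of the two lies in E. *)
Record tiling (s : nat) (delta : R) V (gamma : X -> 'rV[int]_d) E : Prop := Tiling {
  tiling_measV : measurable V;
  tiling_measE : measurable E;
  tiling_meas : forall g, measurable (gamma @^-1` [set g]);
  tiling_bound : exists r, forall x, gamma x \in lattice_ball d r;
  tiling_small : pr E <= delta * pr V;
  tiling_cocycle : forall k x, k \in lattice_ball d s -> V x -> V (alpha k x) ->
    [\/ gamma (alpha k x) + k = gamma x, E x | E (alpha k x)];
  tiling_exit : forall k x, k \in lattice_ball d s -> V x -> ~ V (alpha k x) ->
    E (alpha k x)
}.

Lemma tiling0 s delta : tiling s delta set0 (fun=> 0) set0.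
Proof.
split => //.
- by move=> g; rewrite -[X in measurable X]/(cst 0 @^-1` [set g]) preimage_cst;
    case: ifP.
- by exists 0%N => x; exact: lattice_ball0.
- by rewrite /pr measure0 /= mulr0.
Qed.

(** One step of ball carving. The new tiles are the balls of radius t s around
    the points of B outside V, deprived of V; the spread of B makes the balls
    disjoint and even prevents k from connecting two of them. Since the measure
    of the union of the balls grows by at most a polynomial factor while t
    increases from 0 to T, for some t < T the increment from t to t + 1 is at most
    delta times the measure of the new tiles, and that increment is their outer
    boundary. The boundary towards V is already contained in E, because elements of the ball
    that leave V land in E. *)
Lemma tiling_carve s delta (T : nat) V gamma E B : 0 < delta -> (0 < T)%N ->
  ((2 * (T * s)).+1 ^ d)%:R <= (1 + delta) ^+ T ->
  tiling s delta V gamma E -> measurable B ->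
  spread (lattice_ball d (2 * (T * s) + s)) B ->
  exists V' gamma' E', tiling s delta V' gamma' E' /\ V `|` B `<=` V'.
Proof.
move=> d0 T0 dT [mV mE mg [r0 gr] EV coc exi] mB0 sB0.
pose B1 := B `\` V; have mB : measurable B1 by exact: measurableD.
have sB : spread (lattice_ball d (2 * (T * s) + s)) B1.
  by move=> g x gF gn0 [Bx _] [Bg _]; exact: sB0 gF gn0 Bx Bg.
pose U t := reach (t * s) B1 `\` V.
have mU t : measurable (U t) by apply: measurableD => //; exact: measurable_reach.
have BU : B1 `<=` U 0%N.
  move=> x B1x; split; last by case: B1x.
  by apply/reachP; exists 0; rewrite ?lattice_ball0 // act0.
have [t tT Ut] : exists2 t, (t < T)%N & pr (U t.+1) <= (1 + delta) * pr (U t).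
  apply: (@ratio_pigeonhole _ (fun t => pr (U t)) _ _ (pr B1) T _ _ dT) => //.
  - by rewrite addr_ge0 // ltW.
  - exact: pr_ge0.
  - exact: pr_le.
  apply: le_trans (pr_reach _ mB); apply: pr_le => //; first exact: measurable_reach.
  by move=> x [].
pose P x g := g \in lattice_ball d (t * s) /\ B1 (alpha g x).
(* Two centres related by a vector in the ball of radius 2 T s + s coincide. *)
have P_uniq x k g g' : k \in lattice_ball d s -> P x g -> P (alpha k x) g' -> g' + k = g.
  move=> ks [gt Bg] [gt' Bg']; apply/eqP; rewrite -subr_eq0; apply/negPn/negP => n0.
  apply: (sB _ _ _ n0 Bg).
    rewrite addrAC; apply: lattice_ballD ks.
    apply: (@lattice_ball_le _ (t * s + t * s)); last first.
      by apply: lattice_ballD => //; rewrite lattice_ballN.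
    by rewrite mulSn mul1n leq_add // leq_mul2r ltnW ?orbT.
  by rewrite -actD subrK actD.
pose gamma' x := if x \in V then gamma x else xget 0 [set g | P x g].
have gammaV x : V x -> gamma' x = gamma x.
  by move=> Vx; rewrite /gamma' mem_set.
have gammaU x g : ~ V x -> P x g -> gamma' x = g.
  move=> Vx Pg; rewrite /gamma' memNset //.
  case: xgetP => [h _ Ph|/(_ g)//].
  have := P_uniq x 0 g h; rewrite act0 addr0; apply => //.
  exact: lattice_ball0.
have gammaN x : ~ V x -> ~ reach (t * s) B1 x -> gamma' x = 0.
  move=> Vx Wx; rewrite /gamma' memNset //.
  by case: xgetP => // h _ [ht Bh]; exfalso; apply/Wx/reachP; exists h.
pose V' := V `|` reach (t * s) B1.
have VU : V' = V `|` U t.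
  by rewrite /V' /U setDE setUIr setUv setIT.
exists V', gamma', (E `|` (U t.+1 `\` U t)).
have mW : measurable (reach (t * s) B1) by exact: measurable_reach.
have mV' : measurable V' by exact: measurableU.
have UUS : U t `<=` U t.+1.
  move=> x [/reachP[g gt Bg] Vx]; split=> //; apply/reachP; exists g => //.
  by apply: lattice_ball_le gt; rewrite leq_mul2r leqnSn orbT.
split; last first.
  move=> x [Vx|Bx]; first by left.
  have [Vx|Vx] := pselect (V x); first by left.
  by right; apply/reachP; exists 0; rewrite ?lattice_ball0 // act0.
split => //.
- by apply: measurableU => //; exact: measurableD.
- move=> g.
  have -> : gamma' @^-1` [set g] = (V `&` gamma @^-1` [set g]) `|`
      ((U t `&` (alpha g @^-1` B1 `&` cst g @^-1` [set h | h \in lattice_ball d (t * s)])) `|`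
      (~` V' `&` cst g @^-1` [set 0])).
    apply/seteqP; split=> [x /= gx|x /=].
      have [Vx|Vx] := pselect (V x); first by left; rewrite -gammaV.
      have [Wx|Wx] := pselect (reach (t * s) B1 x).
        right; left; split=> //.
        by have /reachP[h ht Bh] := Wx; rewrite -gx (gammaU x h).
      right; right; split; first by case.
      by rewrite -gx gammaN.
    case=> [[Vx <-]|[[[_ Vx] [Bg gt]]|[nV ->]]].
    - exact: gammaV.
    - exact: gammaU.
    - by apply: gammaN => h; apply: nV; [left|right].
  have mcst (Q : set 'rV[int]_d) : measurable (cst g @^-1` Q : set X).
    by rewrite preimage_cst; case: ifP.
  apply: measurableU; first exact: measurableI.
  apply: measurableU; apply: measurableI => //.
    by apply: measurableI => //; exact: measurable_act.
  exact: measurableC.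
- exists (maxn r0 (t * s)) => x.
  have [Vx|Vx] := pselect (V x).
    by rewrite gammaV //; apply: lattice_ball_le (gr x); rewrite leq_maxl.
  rewrite /gamma' memNset //; case: xgetP => [h _ [ht _]|_]; last exact: lattice_ball0.
  by apply: lattice_ball_le ht; rewrite leq_maxr.
- rewrite VU [X in _ <= delta * X]pr_setU //; last first.
    by apply/seteqP; split=> // x [Vx [_]].
  apply: le_trans (pr_setU_le mE _) _; first exact: measurableD.
  rewrite mulrDr lerD //.
  have -> : pr (U t.+1 `\` U t) = pr (U t.+1) - pr (U t).
    rewrite -[in pr (U t.+1)](setDKU UUS) pr_setU ?addrK //; first exact: measurableD.
    by rewrite setIC setDIK.
  by rewrite lerBlDl; apply: le_trans Ut _; rewrite mulrDl mul1r.
- move=> k x ks V'x V'k.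
  have [Vx|Vx] := pselect (V x); have [Vk|Vk] := pselect (V (alpha k x)).
  + have [e|Ex|Ek] := coc k x ks Vx Vk.
    * by apply: Or31; rewrite !gammaV.
    * by apply: Or32; left.
    * by apply: Or33; left.
  + by apply: Or33; left; exact: exi Vx Vk.
  + apply: Or32; left; have := exi (- k) (alpha k x).
    by rewrite -actD addNr act0 lattice_ballN; apply.
  have /reachP[g gt Bg] : reach (t * s) B1 x by case: V'x.
  have /reachP[g' gt' Bg'] : reach (t * s) B1 (alpha k x) by case: V'k.
  apply: Or31; rewrite (gammaU x g) // (gammaU (alpha k x) g') //.
  exact: (P_uniq x k).
move=> k x ks V'x V'k.
have nVk : ~ V (alpha k x) by move=> h; apply: V'k; left.
have [Vx|Vx] := pselect (V x); first by left; exact: exi Vx _.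
have /reachP[g gt Bg] : reach (t * s) B1 x by case: V'x.
right; split; last by case=> Wk _; apply: V'k; right.
split=> //; apply/reachP; exists (g - k); last by rewrite -actD subrK.
by rewrite mulSn addnC; apply: lattice_ballD => //; rewrite lattice_ballN.
Qed.

Lemma tiling_cover s delta (T : nat) (Bs : seq (set X)) : 0 < delta -> (0 < T)%N ->
  ((2 * (T * s)).+1 ^ d)%:R <= (1 + delta) ^+ T ->
  (forall B, List.In B Bs -> measurable B /\
     spread (lattice_ball d (2 * (T * s) + s)) B) ->
  exists V gamma E, tiling s delta V gamma E /\
    \big[setU/set0]_(B <- Bs) B `<=` V.
Proof.
move=> d0 T0 dT; elim: Bs => [_|B Bs IH BBs].
  by exists set0, (fun=> 0), set0; split; [exact: tiling0|rewrite big_nil].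
have [V [gamma [E [tV BsV]]]] := IH (fun B' h => BBs B' (or_intror h)).
have [mB sB] := BBs B (or_introl erefl).
have [V' [gamma' [E' [tV' VBV']]]] := tiling_carve d0 T0 dT tV mB sB.
exists V', gamma', E'; split => //; rewrite big_cons => x [Bx|Bsx]; apply: VBV'.
  by right.
by left; exact: BsV.
Qed.

End Carving.

(** * An approximate coboundary *)

Section Rokhlin.
Context (R : realType) (d : nat) (disp : measure_display)
  (X : measurableType disp) (mu : probability X R)
  (alpha : pmp_action 'rV[int]_d mu).
Hypothesis hX : standard_borel R X.
Hypothesis hfree : essentially_free alpha.

(** Preimages of a countable basis of the Polish model. *)
Lemma separating_sequence : exists A : nat -> set X,
  (forall n, measurable (A n)) /\
  forall x y, x <> y -> exists2 n, A n x & ~ A n y.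
Proof.
have [Y [f [hY [Bs /countable_injP[i inji] [oB nB]] fbij fmeas]]] := hX.
pose b n : set Y := xget set0 [set U | Bs U /\ i U = n].
have ob n : open (b n).
  have [[U BU]|nU] := pselect (exists U, Bs U /\ i U = n).
    by have [/oB] : [set U | Bs U /\ i U = n] (b n) by apply: xgetPex; exists U.
  by rewrite /b xgetPN => [|U BU]; [exact: open0|apply: nU; exists U].
have bi U : Bs U -> b (i U) = U.
  move=> BU; have [BW iW] : [set W | Bs W /\ i W = i U] (b (i U)).
    by apply: xgetPex; exists U.
  by apply: inji => //; exact: mem_set.
exists (fun n => f @^-1` (b n)); split=> [n|x y xy].
  apply/fmeas.
  by apply: sub_sigma_algebra; exact: ob.
have fxy : f x != f y by apply/eqP => /(bij_inj fbij).
have := hY; rewrite open_hausdorff => /(_ _ _ fxy)[[C D] /= [Cx Dy] [oC oD CD]].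
have [U [BU Ux] UC] : filter_from [set U | Bs U /\ U (f x)] id C.
  by apply: nB; apply: open_nbhs_nbhs; split=> //; exact: set_mem.
exists (i U); rewrite /= bi //.
move=> Uy; have : (C `&` D) (f y) by split; [exact: UC|exact: set_mem].
by rewrite (eqP CD).
Qed.

(** A point x with trivial stabiliser is separated from each g . x, g in F, by a
    member of the separating sequence; choosing such a member for every g defines
    a set around x disjoint from its translates. There are countably many choices,
    so countably many such sets cover almost everything, and finitely many cover
    all but eps. *)
Lemma spread_cover (F : seq 'rV[int]_d) (eps : R) : 0 < eps ->
  exists Bs : seq (set X),
    (forall B, List.In B Bs -> measurable B /\ spread alpha F B) /\
    pr mu (~` \big[setU/set0]_(B <- Bs) B) <= eps.
Proof.
move=> e0; have [A [mA sepA]] := separating_sequence.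
pose ix (nu : seq nat) (g : 'rV[int]_d) := nth 0%N nu (index g F).
pose B (nu : seq nat) : set X := \big[setI/setT]_(g <- F | g != 0)
  (A (ix nu g) `&` alpha g @^-1` (~` A (ix nu g))).
have BP nu x : B nu x <-> forall g, g \in F -> g != 0 ->
    A (ix nu g) x /\ ~ A (ix nu g) (alpha g x).
  rewrite /B -bigcap_seq_cond; split=> [h g gF g0|h g /= /andP[gF g0]].
    by have := h g; apply; rewrite /= gF g0.
  exact: h.
have mB nu : measurable (B nu).
  apply: bigsetI_measurable => g _; apply: measurableI => //.
  by apply: measurable_act; exact: measurableC.
have sB nu : spread alpha F (B nu).
  by move=> g x gF g0 /BP/(_ g gF g0)[_ nA] /BP/(_ g gF g0)[].
pose C (p : nat) : set X := if unpickle p is Some nu then B nu else set0.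
have mC p : measurable (C p) by rewrite /C; case: unpickle.
have sC p : spread alpha F (C p) by rewrite /C; case: unpickle => [nu|//]; exact: sB.
have cov : mu (~` \bigcup_p C p) = 0%E.
  have [N [mN N0 hN]] := hfree.
  apply/eqP; rewrite -measure_le0 -N0; apply: le_measure; rewrite ?inE //.
    by apply: measurableC; exact: bigcup_measurable.
  apply: subset_trans hN => x nCx fx; apply: nCx.
  have /choice[nu nuP] : forall g, exists n, g != 0 -> A n x /\ ~ A n (alpha g x).
    move=> g; have [->|g0] := eqVneq g 0; first by exists 0%N.
    have [n An nAn] : exists2 n, A n x & ~ A n (alpha g x).
      by apply: sepA => xg; move/eqP: g0; apply; apply: fx.
    by exists n.
  exists (pickle [seq nu g | g <- F]) => //; rewrite /C pickleK; apply/BP => g gF g0.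
  by rewrite /ix (nth_map 0) ?index_mem // nth_index //; exact: nuP.
pose D m : set X := ~` \big[setU/set0]_(i < m) C i.
have mD m : measurable (D m) by apply/measurableC/bigsetU_measurable.
have Dcap : \bigcap_m D m = ~` \bigcup_p C p.
  rewrite setC_bigcup; apply/seteqP; split=> x Dx p _.
    by move=> Cx; apply: (Dx p.+1) => //; rewrite -bigcup_mkord; exists p => /=.
  by rewrite /D -bigcup_mkord => -[q _ Cq]; exact: Dx Cq.
have : mu \o D @ \oo --> mu (\bigcap_m D m).
  apply: nonincreasing_cvg_mu => //.
  - by rewrite ltey_eq fin_num_measure.
  - exact: bigcap_measurable.
  move=> m p mp; apply/subsetPset/subsetC => x.
  rewrite -!bigcup_mkord => -[q qm Cq]; exists q => //.
  exact: leq_trans qm mp.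
rewrite Dcap cov => cvD.
have [m _ /(_ m (leqnn m)) Dm] : \forall m \near \oo, (mu (D m) < eps%:E)%E.
  apply: (cvD [set y | (y < eps%:E)%E]); apply: open_nbhs_nbhs.
  by split; [exact: open_ereal_lt_ereal|rewrite /= lte_fin].
exists [seq C i | i <- iota 0 m]; split.
  by move=> _ /List.in_map_iff[p [<- _]]; split; [exact: mC|exact: sC].
rewrite big_map -lee_fin prE; last by apply/measurableC/bigsetU_measurable.
by apply: ltW; move: Dm; rewrite /D -(big_mkord xpredT C) /index_iota subn0.
Qed.

(** A Rokhlin lemma in the form needed for the filling: displacements to the
    centres of tiles that cover all but eps / 4, with boundary of measure at most
    eps / 4. The points outside the tiles are counted as part of the error. *)
Lemma approximate_coboundary (S : seq 'rV[int]_d) (eps : R) : 0 < eps ->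
  exists (gamma : X -> 'rV[int]_d) (L : seq 'rV[int]_d),
    [/\ uniq L, forall x, gamma x \in L,
        forall g, measurable (gamma @^-1` [set g]) &
        forall k, k \in S -> pr mu (defect alpha gamma k) <= eps].
Proof.
move=> e0; have [s Ss] := lattice_ball_sup S.
pose delta := eps / 4; have d0 : 0 < delta by rewrite divr_gt0.
have [T T0 dT] := poly_lt_exp s d d0.
have [Bs [BsP Bscov]] := spread_cover (lattice_ball d (2 * (T * s) + s)) d0.
have [V [gamma [E [[mV mE mg [r gr] EV coc exi] BV]]]] := tiling_cover d0 T0 dT BsP.
exists gamma, (undup (lattice_ball d r)).
have gL x : gamma x \in undup (lattice_ball d r) by rewrite mem_undup.
split => //; first exact: undup_uniq.
move=> k /Ss ks.
have mdefect : measurable (defect alpha gamma k).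
  exact: (measurable_defect alpha gL mg).
have mVc : measurable (~` V) by exact: measurableC.
have mEk : measurable (alpha k @^-1` E) by exact: measurable_act.
have prV : pr mu V <= 1.
  by rewrite -lee_fin prE // probability_le1.
have prE1 : pr mu E <= delta by apply: le_trans EV _; rewrite ler_piMr // ltW.
have prVc : pr mu (~` V) <= delta.
  apply: le_trans Bscov; apply: pr_le => //; last exact: subsetC.
  apply/measurableC.
  elim: (Bs) BsP => [_|B Bs' IH h]; first by rewrite big_nil.
  rewrite big_cons; apply: measurableU; first by have [] := h B (or_introl erefl).
  by apply: IH => B' B'in; apply: h; right.
have sub : defect alpha gamma k `<=` ~` V `|` (E `|` alpha k @^-1` E).
  move=> x bx; have [Vx|] := pselect (V x); last by left.
  right; have [Vk|Vk] := pselect (V (alpha k x)).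
    by have [e|Ex|Ek] := coc k x ks Vx Vk; [exfalso; exact: bx|left|right].
  by right; exact: exi Vx Vk.
have mU : measurable (E `|` alpha k @^-1` E) by exact: measurableU.
have le1 := pr_le mu mdefect (measurableU _ _ mVc mU) sub.
have le2 := pr_setU_le mu mVc mU.
have := pr_setU_le mu mE mEk; rewrite pr_act // => le3.
rewrite /delta in prE1 prVc; lra.
Qed.

End Rokhlin.

(** * The uniform boundary condition *)

Theorem theorem1p3 (R : realType) (d : nat) (hd : (0 < d)%N)
    (disp : measure_display) (X : measurableType disp) (mu : probability X R)
    (alpha : pmp_action 'rV[int]_d mu)
    (hX : standard_borel R X) (hfree : essentially_free alpha) :
  forall n : nat, exists K : R, 0 < K /\
    forall c : twisted_chain (torus_covering R d) alpha n,
      twisted_cycle c -> null_homologous c ->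
      exists b : twisted_chain (torus_covering R d) alpha n.+1,
        twisted_bd b = c /\ twisted_norm b <= K * twisted_norm c.
Proof.
move=> n; exists 2; split=> // c _ [b0 b0c].
have pos_push m (s : sing R (cover (torus_covering R d)) m) g :
    floor_pos (sing_push (deck (torus_covering R d) g) s) = g + floor_pos s.
  exact: floor_pos_translate.
have [c0|cn0] := eqVneq c 0.
  exists 0; rewrite c0 (additive_morph0 (@twisted_bdD _ _ _ _ _ _ _ _ _)).
  by rewrite !(twisted_norm0 _ (@pos_push _)) mulr0.
have cpos : 0 < twisted_norm c.
  rewrite lt_neqAle twisted_norm_ge0 andbT eq_sym.
  by apply: contra_neq cn0; exact: (twisted_norm_eq0 (@pos_push n)).
have [r0 b0r] := twisted_chain_sum b0.
pose r := [seq (repr p.1, p.2) | p <- r0].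
have b0E : b0 = \sum_(p <- r) twisted_tens alpha (linf_class p.1) << p.2 >>.
  by rewrite b0r big_map; apply: eq_bigr => p _; rewrite linf_classK.
have /choice[beta betaP] (f : linf_fun mu) :
    exists b : R, 0 <= b /\ \forall x \ae mu, `|f x|%:~R <= b.
  by have [b ? ?] := linf_fun_bounded f; exists b.
pose Q := face_seq r.
pose C := \sum_(p <- Q) beta p.1 *+ 2.
(* The error of the filling is at most C times the measure of a defect. *)
have C0 : 0 <= C by apply: sumr_ge0 => p _; rewrite mulrn_wge0 //; case: (betaP p.1).
have C1 : 0 < C + 1 by rewrite ltr_wpDl.
have e0 : 0 < twisted_norm c / (C + 1) by rewrite divr_gt0.
have [gamma [L [uL gL mg small]]] := approximate_coboundary hX hfree
  [seq floor_pos p.2 | p <- Q] e0.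
exists (fill (U := torus_covering R d) alpha (@cone R d n) L mg Q); split.
  rewrite fill_bd // -?b0E //; exact: sing_bd_cone.
have := fill_norm alpha (@pos_push n) (@pos_push n.+1) (@cone R d n) uL gL mg Q betaP.
rewrite face_seq_bd -b0E b0c => /le_trans; apply.
rewrite mulr_natl mulr2n lerD2l.
apply: le_trans (_ : C * (twisted_norm c / (C + 1)) <= _).
  rewrite /C mulr_suml big_seq [leRHS]big_seq; apply: ler_sum => p pQ.
  apply: ler_wpM2l; first by rewrite mulrn_wge0 //; case: (betaP p.1).
  by apply: small; apply/mapP; exists p.
by rewrite mulrCA ger_pMr // ler_pdivrMr // mul1r lerDl.
Qed.
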